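(* Assume that $\operatorname{cov}(\mathcal{M})=\operatorname{cof}(\mathcal{M})$ and that the cardinal number $\operatorname{cov}(\mathcal{M})$ is regular. Then there are hereditary Rothberger sets of reals $X$ and $Y$ such that the spaces $\mathrm{C}_{\mathrm{p}}(X)$ and $\mathrm{C}_{\mathrm{p}}(Y)$ have countable strong fan tightness (and are R-separable), but the product space $\mathrm{C}_{\mathrm{p}}(X)\times\mathrm{C}_{\mathrm{p}}(Y)$ does not have countable fan tightness (and is not M-separable).
   Context: $\operatorname{cov}(\mathcal{M})$ is the minimal cardinality of a family of meager subsets of $\mathbb{R}$ that covers $\mathbb{R}$; $\operatorname{cof}(\mathcal{M})$ is the minimal cardinality of a family of meager subsets of $\mathbb{R}$ such that every meager subset of $\mathbb{R}$ is contained in a member of the family. A set of reals is a space homeomorphic to a subset of the real line. A space $X$ is Rothberger if for every sequence $\mathcal{U}_1,\mathcal{U}_2,\dots$ of open covers of $X$ there are $U_1\in\mathcal{U}_1,U_2\in\mathcal{U}_2,\dots$ such that $\{U_n:n\in\mathbb{N}\}$ covers $X$; it is hereditary Rothberger if every subspace of it is Rothberger. $\mathrm{C}_{\mathrm{p}}(X)$ is the space of all continuous real-valued functions on $X$ with the topology of pointwise convergence. A space $Z$ has countable fan tightness if for each point $z\in Z$ and every sequence $U_1,U_2,\dots$ of subsets of $Z$ with $z\in\bigcap_n\overline{U_n}$ there are finite sets $F_1\subseteq U_1,F_2\subseteq U_2,\dots$ with $z\in\overline{\bigcup_n F_n}$; if the sets $F_n$ can always be chosen to be singletons, $Z$ has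 countable strong fan tightness. A space is M-separable if for every sequence $D_1,D_2,\dots$ of dense subsets of the space there are finite sets $F_1\subseteq D_1,F_2\subseteq D_2,\dots$ such that $\bigcup_nF_n$ is dense in the space; if the sets $F_n$ can always be chosen to be singletons, the space is R-separable. *)

(* Defs.v *)
From HB Require Import structures.
From mathcomp Require Import all_boot all_order all_algebra.
From mathcomp Require Import boolp classical_sets functions cardinality.
From mathcomp Require Import reals topology normedtype.

Set Implicit Arguments.
Unset Strict Implicit.
Unset Printing Implicit Defensive.

Import numFieldNormedType.Exports.
Local Open Scope classical_set_scope.
Local Open Scope card_scope.

(** Cardinals are represented by sets, compared with [#<=] and [#=]. *)

Definition card_lt (T U : Type) (A : set T) (B : set U) : Prop :=
  A #<= B /\ ~ (B #<= A).

Definition least_card (T : Type) (P : set (set T)) (F : set T) : Prop :=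
  P F /\ forall G : set T, P G -> F #<= G.

(** An infinite cardinal is regular when it is not a union of fewer than |K|
    sets of cardinality less than |K|.  Indexing the union by a subset of [T]
    loses nothing: anything smaller than [K] injects into [T]. *)
Definition regular_card (T : Type) (K : set T) : Prop :=
  infinite_set K /\
  forall (J : set T) (F : T -> set T),
    card_lt J K -> (forall j, J j -> card_lt (F j) K) ->
    ~ (K `<=` \bigcup_(j in J) F j).

Section Meager.
Variable T : topologicalType.

Definition nowhere_dense (A : set T) : Prop := interior (closure A) = set0.

Definition meager (A : set T) : Prop :=
  exists2 N : nat -> set T,
    (forall n, nowhere_dense (N n)) & A = \bigcup_n N n.

Definition meager_cover (F : set (set T)) : Prop :=
  F `<=` meager /\ \bigcup_(A in F) A = setT.

Definition meager_cofinal (F : set (set T)) : Prop :=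
  F `<=` meager /\ forall A, meager A -> exists2 B, F B & A `<=` B.

End Meager.

(** The cardinality of [K] is cov(M). *)
Definition has_card_cov (R : realType) (K : set (set R)) : Prop :=
  least_card (@meager_cover R) K.

(** The cardinality of [K] is cof(M). *)
Definition has_card_cof (R : realType) (K : set (set R)) : Prop :=
  least_card (@meager_cofinal R) K.

Definition homeomorphic (X Y : topologicalType) : Prop :=
  exists (f : X -> Y) (g : Y -> X),
    [/\ continuous f, continuous g, cancel f g & cancel g f].

Definition set_of_reals (R : realType) (X : topologicalType) : Prop :=
  exists A : set R, homeomorphic X (set_type A).

(** Covers are required to have at least one member.  This is automatic unless
    [X] is empty; it makes the empty space Rothberger, as the hereditary
    version needs, instead of failing on the empty cover. *)
Definition open_cover (X : topologicalType) (U : set (set X)) : Prop :=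
  [/\ U !=set0, U `<=` open & \bigcup_(A in U) A = setT].

Definition rothberger (X : topologicalType) : Prop :=
  forall U : nat -> set (set X), (forall n, open_cover (U n)) ->
  exists2 V : nat -> set X, (forall n, U n (V n)) & \bigcup_n V n = setT.

Definition hereditary_rothberger (X : topologicalType) : Prop :=
  forall A : set X, rothberger (set_type A).

(** Continuous functions with the topology inherited from the product. *)
Definition Cp (R : realType) (X : topologicalType) : topologicalType :=
  initial_topology (id : continuousType X R -> {ptws X -> R}).

Section Selection.
Variable Z : topologicalType.

Definition countable_fan_tightness : Prop :=
  forall (z : Z) (U : nat -> set Z), (forall n, closure (U n) z) ->
  exists2 F : nat -> set Z,
    (forall n, finite_set (F n) /\ F n `<=` U n) & closure (\bigcup_n F n) z.

Definition countable_strong_fan_tightness : Prop :=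
  forall (z : Z) (U : nat -> set Z), (forall n, closure (U n) z) ->
  exists2 x : nat -> Z, (forall n, U n (x n)) & closure (range x) z.

Definition M_separable : Prop :=
  forall D : nat -> set Z, (forall n, dense (D n)) ->
  exists2 F : nat -> set Z,
    (forall n, finite_set (F n) /\ F n `<=` D n) & dense (\bigcup_n F n).

Definition R_separable : Prop :=
  forall D : nat -> set Z, (forall n, dense (D n)) ->
  exists2 x : nat -> Z, (forall n, D n (x n)) & dense (range x).

End Selection.

(* Main.v *)
(**
Let kappa = cov(M) = cof(M), and fix a cofinal family of kappa comeager subsets of the Cantor space,
which binary digits relate to the real line.  By recursion of length kappa choose points x_a such that
increasing tuples above a avoid, by the Kuratowski-Ulam theorem, the first a meager sets in all finite
dimensions, and such that y_a = x_a + t_a has the same property; here t_a is a 0-1 matrix whose rows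
have their first 1 at the values of a function g_a, and the g_a are dominating because d <= cof(M).
Genericity also ensures that no row of a sum x_a + y_b vanishes.

Every subset of X = {x_a} and of Y = {y_a} satisfies S_1(Omega, Omega): a selection that handles a
countable dense set handles all increasing tuples with large indices, regularity of kappa bounds the
remaining indices, and fewer than kappa = cov(M) finite sets are handled at once.  This yields the
Rothberger property, and the strong fan tightness and R-separability of the function spaces (Sakai).
On the other hand the first 1 in row n of x + y is a continuous function on X x Y, and the sequences
of these values are dominating; hence X x Y is not Menger, which refutes fan tightness and
M-separability of C_p(X) x C_p(Y).
*)
Require Import Defs.
From mathcomp Require Import all_boot all_order all_algebra.
From mathcomp Require Import wochoice boolp classical_sets functions cardinality.
From mathcomp Require Import reals topology normedtype sequences.
From mathcomp Require Import zify lra ring.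

Set Implicit Arguments.
Unset Strict Implicit.
Unset Printing Implicit Defensive.

Import Order.TTheory GRing.Theory Num.Theory numFieldNormedType.Exports.
Local Open Scope classical_set_scope.
Local Open Scope card_scope.

(** * Cardinality *)

(* |A| < |K|, stated through surjections; boolean so that it is not unfolded to an implication. *)
Definition small (T : Type) (K : set T) (U : Type) (A : set U) : bool :=
  `[< ~ exists g : U -> T, K `<=` g @` A >].

Lemma smallP (T : Type) (K : set T) (U : Type) (A : set U) :
  reflect (~ exists g : U -> T, K `<=` g @` A) (small K A).
Proof. exact: asboolP. Qed.

Section Small.
Variables (T : pointedType) (K : set T).
Hypothesis Kreg : regular_card K.
Hypothesis Kunc : small K [set: nat].

Lemma small_card_le U (A : set U) : small K A <-> ~ (K #<= A).
Proof.
split=> [/smallP|nKA]; first by apply: contra_not => /pcard_surjP.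
by apply/smallP; apply: contra_not nKA => ?; apply/pcard_surjP.
Qed.

Lemma small_image U V (A : set U) (B : set V) (g : U -> V) :
  small K A -> B `<=` g @` A -> small K B.
Proof.
move=> /smallP sA BA; apply/smallP => -[h Kh]; apply: sA; exists (h \o g) => k /Kh[b /BA[a Aa <-] <-].
by exists a.
Qed.

Lemma small_sub U (A B : set U) : small K A -> B `<=` A -> small K B.
Proof. by move=> sA BA; apply: (small_image (g := id) sA); rewrite image_id. Qed.

Lemma small_countable U (A : set U) (g : nat -> U) :
  A `<=` range g -> small K A.
Proof. exact: small_image. Qed.

(** A surjection of the union onto [K] splits [K] into classes, one for each index in [A]. The
    classes are few and each is small, against regularity. *)
Lemma small_bigcup J U (A : set J) (F : J -> set U) :
  small K A -> (forall j, A j -> small K (F j)) ->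
  small K (\bigcup_(j in A) F j).
Proof.
move=> sA sF; apply/smallP => -[g Kg].
have /choice[jj jjP] : forall k, exists j, K k -> A j /\ (g @` F j) k.
  move=> k; have [/Kg[u [j Aj Fu] <-]|nK] := pselect (K k).
    by exists j => _; split => //; exists u.
  have [[j _]|nJ] := pselect (exists j : J, True); first by exists j.
  have [k0 Kk0] : K !=set0.
    apply/set0P/negP => /eqP K0; have [fK _] := Kreg.
    by apply: fK; rewrite K0; exact: finite_set0.
  by have [_ [j _ _] _] := Kg _ Kk0; exfalso; apply: nJ; exists j.
(* Regularity speaks of unions indexed by a subset of [T], so each class is named by a
   representative in [K]. *)
have /choice[r rP] : forall j, exists k, forall k', K k' -> jj k' = j ->
    K k /\ jj k = j.
  move=> j; have [[k [Kk kj]]|nk] := pselect (exists k, K k /\ jj k = j).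
    by exists k.
  by exists point => k' Kk' k'j; exfalso; apply: nk; exists k'.
pose J' := (r \o jj) @` K.
have J'K : J' `<=` K by move=> _ [k Kk <-]; have [] := rP _ _ Kk erefl.
have sJ' : small K J'.
  apply: (small_image sA (g := r)) => _ [k Kk <-].
  by exists (jj k) => //; have [] := jjP _ Kk.
have [_ /(_ J' (fun t => [set k | K k /\ jj k = jj t]))] := Kreg.
apply.
- by split; [exact: subset_card_le|exact/small_card_le].
- move=> t /J'K Kt; split; first by apply: subset_card_le => k [].
  have [Aj _] := jjP _ Kt.
  apply/small_card_le/(small_image (sF _ Aj) (g := g)) => k [/jjP[_ Fk] <-] //.
- by move=> k Kk; exists (r (jj k)); [exists k|split=> //; have [_ ->] := rP _ _ Kk erefl].
Qed.

Lemma small1 U (u : U) : small K [set u].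
Proof. by apply: (small_countable (g := fun=> u)) => _ ->; exists 0%N. Qed.

Lemma smallU U (A B : set U) : small K A -> small K B -> small K (A `|` B).
Proof.
move=> sA sB; rewrite -(bigcup2inE A B).
apply: small_bigcup => [|[|[|//]] _ //].
exact: small_sub Kunc _.
Qed.

Lemma smallX U V (A : set U) (B : set V) :
  small K A -> small K B -> small K (A `*` B).
Proof.
move=> sA sB.
apply: (@small_sub _ (\bigcup_(a in A) [set (a, b) | b in B])).
  by apply: small_bigcup => // a _; apply: (small_image (g := pair a) sB).
by move=> [a b] [/= Aa Bb]; exists a => //; exists b.
Qed.

Lemma small_seq (U : eqType) (A : set U) :
  small K A -> small K [set s : seq U | {in s, forall x, A x}].
Proof.
move=> sA.
apply: (@small_sub _ (\bigcup_n [set s : seq U | size s = n /\ {in s, forall x, A x}])).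
  apply: small_bigcup => // n _; elim: n => [|n IHn].
    by apply: (small_sub (small1 [::])) => s [/size0nil ->].
  apply: (small_image (smallX sA IHn) (g := fun p => p.1 :: p.2)).
  move=> [|x s] [//= [sn] sP]; exists (x, s) => //=.
  split; first by apply: sP; rewrite mem_head.
  by split=> // y ys; apply: sP; rewrite inE ys orbT.
by move=> s sP; exists (size s).
Qed.

(* [{b < a}] is small for every [a], i.e. [I] is ordered in type an initial ordinal. *)
Lemma small_initial_order : exists (I : choiceType) (lt : I -> I -> Prop),
  [/\ well_founded lt, forall a b c, lt a b -> lt b c -> lt a c,
      forall a b, [\/ lt a b, a = b | lt b a],
      (forall a, small K [set b | lt b a]) & ~ small K [set: I]].
Proof.
have [r rwo] := well_ordering_principle {classic T}.
have rchain : {in predT &, total r} by apply: wo_chainW => A _; exact: rwo.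
have rtot a b : r a b || r b a by exact: rchain.
have minE (A : set T) : A !=set0 -> exists2 m, A m & forall b, A b -> r m b.
  move=> [x Ax].
  have /rwo[z [[Az zP] _]] : wochoice.nonempty (fun t : {classic T} => `[< A t >]).
    by exists x; exact/asboolP.
  by exists z => [|b Ab]; [exact/asboolP|apply: zP; exact/asboolP].
(* Antisymmetry follows from uniqueness of the minimum of a pair, transitivity from the minimum of a
   triple. *)
have ranti a b : r a b -> r b a -> a = b.
  move=> rab rba.
  have /rwo[z [_ zP]] : wochoice.nonempty (mem [:: (a : {classic T}); b]).
    by exists a; rewrite !inE eqxx.
  have raa x : r x x by have := rtot x x; rewrite orbb.
  transitivity z; [symmetry|]; apply: zP; split; rewrite ?inE ?eqxx ?orbT//.
    by move=> x; rewrite !inE => /orP[] /eqP ->.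
  by move=> x; rewrite !inE => /orP[] /eqP ->.
have rtrans a b c : r a b -> r b c -> r a c.
  move=> rab rbc.
  have [|m mS mP] := minE [set x | [\/ x = a, x = b | x = c]].
    by exists a; constructor 1.
  case: mS => mE; subst m.
  - by apply: mP; constructor 3.
  - by rewrite (ranti a b rab) // mP//; constructor 1.
  - have cb : c = b by apply: ranti => //; apply: mP; constructor 2.
    by rewrite cb.
(* Either all of [K] is good, or the good members include the segment below the least bad one, which
   is not small; in both cases they can be mapped onto [K]. *)
pose good a := K a /\ small K [set b | K b /\ ~~ r a b].
exists {classic set_type good}, (fun a b => ~~ r (val b) (val a)).
split.
- move=> a; apply: contrapT => na.
  have [|m [Gm nm] mP] := minE [set x | exists Gx : good x,
      ~ Acc (fun a b : set_type good => ~~ r (val b) (val a)) (exist _ x (mem_set Gx))].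
    case: a na => x Gx na; exists x; exists (set_mem Gx) => ac; apply: na.
    by rewrite (Prop_irrelevance Gx (mem_set (set_mem Gx))).
  apply: nm; constructor => -[b Gb] /= nmb; apply: contrapT => nb.
  move/negP: nmb; apply; apply: mP; exists (set_mem Gb) => ac; apply: nb.
  by rewrite (Prop_irrelevance Gb (mem_set (set_mem Gb))).
- move=> a b c /negP ab /negP bc; apply/negP => ca; apply: ab.
  by case/orP: (rtot (val b) (val c)) => [bc'|//]; exact: rtrans bc' ca.
- move=> a b; case/boolP: (r (val b) (val a)) => ba; last by constructor 1.
  case/boolP: (r (val a) (val b)) => ab; last by constructor 3.
  by constructor 2; apply: val_inj; exact: ranti.
- move=> a; have [Ka sa] : good (val a) by exact: (set_mem (valP a)).
  apply/smallP => -[g Kg]; move/smallP: sa; apply.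
  have [[k0 Gk0]|nk] := pselect (exists k, good k); last first.
    by exfalso; apply: nk; exists (val a); exact: (set_mem (valP a)).
  exists (fun t => if pselect (good t) is left p then g (exist _ t (mem_set p)) else point).
  move=> k /Kg[[b Gb] /= ba <-]; exists b; first by split=> //; have [] := set_mem Gb.
  case: pselect => [p|]; last by case; exact: set_mem.
  by congr (g _); apply: val_inj.
- have [allgood|] := pselect (K `<=` good).
    move=> /smallP; apply; exists val => k Kk; exists (exist _ k (mem_set (allgood _ Kk))) => //.
  move=> /existsNP[a0 /not_implyP[Ka0 nga0]].
  have [|m [Km ngm] mP] := minE [set a | K a /\ ~ good a]; first by exists a0.
  move=> /smallP; apply.
  have /smallP/contrapT[g Kg] : ~~ small K [set b | K b /\ ~~ r m b].
    by apply/negP => sm; apply: ngm; split.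
  exists (g \o val) => k /Kg[b [Kb mb] <-].
  have gb : good b by apply: contrapT => ngb; case/negP: mb; exact: mP.
  by exists (exist _ b (mem_set gb)).
Qed.

Lemma small_bounded I (lt : I -> I -> Prop) (A : set I) :
  (forall a b, [\/ lt a b, a = b | lt b a]) ->
  (forall a, small K [set b | lt b a]) -> ~ small K [set: I] ->
  small K A -> exists c, forall a, A a -> lt a c.
Proof.
move=> lttot ltsmall nI sA; apply: contrapT => nbd; apply: nI.
apply: (@small_sub _ (\bigcup_(a in A) ([set b | lt b a] `|` [set a]))).
  by apply: small_bigcup => // a _; apply: smallU => //; exact: small1.
move=> c _; have /forallNP/(_ c)/existsNP[a /not_implyP[Aa nac]] := nbd.
by exists a => //; case: (lttot c a) => [?|->|//]; [left|right].
Qed.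

End Small.

(** * Category in the Cantor space *)

Definition bits := nat -> bool.

Definition agree (n : nat) (s t : bits) : Prop := forall i, (i < n)%N -> s i = t i.

Lemma agree_refl n s : agree n s s. Proof. by []. Qed.

Lemma agree_sym n s t : agree n s t -> agree n t s.
Proof. by move=> st i /st. Qed.

Lemma agree_trans n s t u : agree n s t -> agree n t u -> agree n s u.
Proof. by move=> st tu i ni; rewrite st// tu. Qed.

Lemma agree_le m n s t : (m <= n)%N -> agree n s t -> agree m s t.
Proof. by move=> mn st i im; apply/st/(leq_trans im). Qed.

Definition dense_open (O : set bits) : Prop :=
  (forall s, O s -> exists n, forall t, agree n s t -> O t) /\
  (forall s n, exists2 t, agree n s t & O t).

Definition comeager (G : set bits) : Prop :=
  exists2 O : nat -> set bits, forall n, dense_open (O n) & \bigcap_n O n `<=` G.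

Lemma dense_open_comeager O : dense_open O -> comeager O.
Proof. by move=> dO; exists (fun=> O) => // s /(_ 0%N I). Qed.

Lemma sub_comeager G H : G `<=` H -> comeager G -> comeager H.
Proof. by move=> GH [O dO OG]; exists O => // s /OG/GH. Qed.

Lemma comeager_forall (J : countType) (G : J -> set bits) :
  (forall j, comeager (G j)) -> comeager [set s | forall j, G j s].
Proof.
move=> cG.
have /choice[O OP] : forall j, exists O : nat -> set bits,
    (forall n, dense_open (O n)) /\ \bigcap_n O n `<=` G j.
  by move=> j; have [O] := cG j; exists O.
exists (fun i => if unpickle i is Some (j, n) then O j n else setT).
  move=> i; case: (unpickle i) => [[j n]|]; first by have [] := OP j.
  by split=> // [s|s n]; [exists 0%N|exists s].
move=> s Os j; have [_] := OP j; apply => n _.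
by have := Os (pickle (j, n)) I; rewrite pickleK.
Qed.

Lemma comeagerI G H : comeager G -> comeager H -> comeager (G `&` H).
Proof.
move=> cG cH; pose F (b : bool) := if b then G else H.
apply: (@sub_comeager [set s | forall b, F b s]).
  by move=> s Fs; split; [exact: (Fs true)|exact: (Fs false)].
by apply: comeager_forall => -[].
Qed.

Definition xor (s t : bits) : bits := fun i => s i (+) t i.

Lemma xorK t s : xor (xor s t) t = s.
Proof. by apply/funext => i; rewrite /xor addbK. Qed.

Lemma agree_xor n s t u : agree n s t -> agree n (xor s u) (xor t u).
Proof. by move=> st i /st; rewrite /xor => ->. Qed.

Lemma comeager_xor t G : comeager G -> comeager [set s | G (xor s t)].
Proof.
move=> [O dO OG]; exists (fun n => [set s | O n (xor s t)]).
  move=> n; have [oO deO] := dO n; split=> [s /oO[m mP]|s m].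
    by exists m => u su; apply/mP/agree_xor.
  have [u su Ou] := deO (xor s t) m; exists (xor u t); last by rewrite /= xorK.
  by rewrite -(xorK t s); exact: agree_xor.
by move=> s Os; apply: OG => n _; exact: Os.
Qed.

(* A homeomorphism between pairs of sequences and sequences; it replaces powers of the space. *)
Definition cons_bits (x s : bits) : bits :=
  fun i => if odd i then s i./2 else x i./2.
Definition head_bits (s : bits) : bits := fun i => s i.*2.
Definition tail_bits (s : bits) : bits := fun i => s i.*2.+1.

Lemma head_cons x s : head_bits (cons_bits x s) = x.
Proof. by apply/funext => i; rewrite /head_bits /cons_bits odd_double doubleK. Qed.

Lemma tail_cons x s : tail_bits (cons_bits x s) = s.
Proof.
by apply/funext => i; rewrite /tail_bits /cons_bits /= odd_double /= uphalf_double.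
Qed.

Lemma cons_head_tail s : cons_bits (head_bits s) (tail_bits s) = s.
Proof.
apply/funext => i; rewrite /cons_bits /head_bits /tail_bits -[in RHS](odd_double_half i).
by case: (odd i).
Qed.

Lemma agree_cons n x y s t :
  agree n x y -> agree n s t -> agree n (cons_bits x s) (cons_bits y t).
Proof.
move=> xy st i ni; have ni2 : (i./2 < n)%N by lia.
by rewrite /cons_bits xy// st.
Qed.

Lemma agree_head n s t : agree n.*2 s t -> agree n (head_bits s) (head_bits t).
Proof. by move=> st i ni; apply: st; lia. Qed.

Lemma agree_tail n s t : agree n.*2 s t -> agree n (tail_bits s) (tail_bits t).
Proof. by move=> st i ni; apply: st; lia. Qed.

Lemma agree_mkseq s n : agree n s (nth false (mkseq s n)).
Proof. by move=> i ni; rewrite nth_mkseq. Qed.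

(** For each of the countably many strings [w], the set [D w] of points [x] whose section meets the
    cylinder of [w] is open and dense. *)
Lemma dense_open_section O :
  dense_open O -> comeager [set x | dense_open [set s | O (cons_bits x s)]].
Proof.
move=> [oO dO].
pose D (w : seq bool) := [set x | exists2 t, agree (size w) (nth false w) t & O (cons_bits x t)].
apply: (@sub_comeager [set x | forall w, D w x]).
  move=> x Dx; split=> [s /oO[n nP]|s n].
    by exists n => t st; apply/nP/agree_cons.
  have [t] := Dx (mkseq s n); rewrite size_mkseq => wt Ot; exists t => //.
  exact: agree_trans (@agree_mkseq s n) wt.
apply: comeager_forall => w; apply: dense_open_comeager; split.
  move=> x [t wt /oO[n nP]]; exists n => y xy; exists t => //.
  exact/nP/agree_cons.
move=> x n.
have [t xt Ot] := dO (cons_bits x (nth false w)) (n + size w).*2.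
exists (head_bits t).
  by rewrite -(head_cons x (nth false w)); apply: (agree_le (leq_addr (size w) n)); exact: agree_head.
exists (tail_bits t); last by rewrite cons_head_tail.
rewrite -[in X in agree _ X](tail_cons x (nth false w)).
by apply: (agree_le (leq_addl n (size w))); exact: agree_tail.
Qed.

(* Kuratowski-Ulam *)
Lemma comeager_section G :
  comeager G -> comeager [set x | comeager [set s | G (cons_bits x s)]].
Proof.
move=> [O dO OG].
apply: (@sub_comeager [set x | forall n, dense_open [set s | O n (cons_bits x s)]]).
  move=> x dx; exists (fun n => [set s | O n (cons_bits x s)]) => // s Os.
  by apply: OG => n _; exact: Os.
by apply: comeager_forall => n; exact: dense_open_section.
Qed.

(* Sequences are also read as matrices, entry (n, j) being at index [code n j]. *)
Definition code (n j : nat) : nat := pickle (n, j).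

Definition of_rows (f : nat -> nat -> bool) : bits :=
  fun i => if unpickle i is Some (n, j) then f n j else false.

Lemma of_rowsE f n j : of_rows f (code n j) = f n j.
Proof. by rewrite /of_rows pickleK. Qed.

Lemma code_large l : exists n, forall j, (l <= code n j)%N.
Proof.
suff [n nP] : exists n, forall m j, (n <= m)%N -> (l <= code m j)%N.
  by exists n => j; exact: nP.
elim: l => [|l [n nP]]; first by exists 0%N.
exists (if @unpickle (nat * nat)%type l is Some (m, _) then maxn n m.+1 else n) => m j nm.
rewrite ltn_neqAle; apply/andP; split.
  apply/eqP => lE; move: nm; rewrite lE /code pickleK; lia.
by apply: nP; case: (unpickle l) nm => [[m' _]|]; lia.
Qed.

Definition splice (n : nat) (s u : bits) : bits := fun i => if (i < n)%N then s i else u i.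

Lemma agree_splice n s u : agree n s (splice n s u).
Proof. by move=> i ni; rewrite /splice ni. Qed.

Lemma spliceE n s u i : (n <= i)%N -> splice n s u i = u i.
Proof. by rewrite /splice ltnNge => ->. Qed.

Lemma comeager_rows : comeager [set s : bits | forall n, exists j, s (code n j)].
Proof.
apply: comeager_forall => n; apply: dense_open_comeager; split.
  by move=> s [j sj]; exists (code n j).+1 => t st; exists j; rewrite -st.
move=> s m; have [j mj] : exists j, (m <= code n j)%N.
  have inj : injective (code n) by move=> j k /(pcan_inj pickleK)[].
  by have [j mj] := injective_gtn inj m; exists j; exact: ltnW.
exists (splice m s (fun=> true)); first exact: agree_splice.
by exists j; rewrite spliceE.
Qed.

Lemma comeager_infinite b :
  comeager [set s : bits | forall n, exists2 i, (n <= i)%N & s i = b].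
Proof.
apply: comeager_forall => n; apply: dense_open_comeager; split.
  by move=> s [i ni si]; exists i.+1 => t st; exists i => //; rewrite -st.
move=> s m; exists (splice m s (fun=> b)); first exact: agree_splice.
by exists (maxn n m); rewrite ?spliceE; lia.
Qed.

(** Compactness in finite form: [P] depends only on the first [n] bits, so a maximum over the
    [n]-tuples works. *)
Lemma uniform_bound (n : nat) (P : bits -> nat -> Prop) :
  (forall s t m, agree n s t -> P s m -> P t m) ->
  (forall s m m', (m <= m')%N -> P s m -> P s m') ->
  (forall s, exists m, P s m) -> exists m, forall s, P s m.
Proof.
move=> Pext Pmono /choice[m mP].
pose str (u : n.-tuple bool) : bits := nth false u.
exists (\max_(u : n.-tuple bool) m (str u)) => s.
have sz : size (mkseq s n) == n by rewrite size_mkseq.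
apply: (Pext (str (Tuple sz))).
  by apply: agree_sym; exact: agree_mkseq.
apply: Pmono (mP _); exact: (leq_bigmax (F := fun u => m (str u))).
Qed.

Definition zero_blocks (h : nat -> nat) : set bits :=
  [set s | forall m, exists2 k, (m <= k)%N & forall i, (k <= i <= h k)%N -> s i = false].

Lemma comeager_zero_blocks h : comeager (zero_blocks h).
Proof.
apply: comeager_forall => m; apply: dense_open_comeager; split.
  move=> s [k mk sk]; exists (h k).+1 => t st; exists k => // i ik.
  by rewrite -st ?sk//; lia.
move=> s n; exists (splice n s (fun=> false)); first exact: agree_splice.
by exists (maxn m n) => [|i]; [|move=> ?; rewrite spliceE]; lia.
Qed.

(* The combinatorial core of d <= cof(M).  If [h k > g k] infinitely often, then extending finite
   strings into the dense open sets within length [g k], and filling up with ones, yields a member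
   of [G] without zero blocks [[k, h k]]. *)
Lemma comeager_dominating G : comeager G -> exists g : nat -> nat,
  forall h : nat -> nat, {homo h : m n / (m <= n)%N} -> (forall n, n <= h n)%N ->
  G `<=` zero_blocks h -> exists N, forall n, (N <= n)%N -> (h n <= g n)%N.
Proof.
move=> [O dO OG].
pose P k (s : bits) m := exists2 t, agree k s t & forall u, agree m t u ->
  forall j, (j <= k)%N -> O j u.
(* Within length [g k], every string of length [k] can be extended so as to force membership in
   [O 0], ..., [O k]. *)
have /choice[g gP] : forall k, exists m, forall s, (k <= m)%N /\ P k s m.
  move=> k; suff [m mP] : exists m, forall s, P k s m.
    exists (maxn k m) => s; split; first lia.
    have [t st tP] := mP s; exists t => // u tu; apply: tP.
    by apply: agree_le tu; lia.
  apply: (@uniform_bound k).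
  - by move=> s t m st [u su uP]; exists u => //; exact: agree_trans (agree_sym st) su.
  - move=> s m m' mm' [t st tP]; exists t => // u tu; apply: tP.
    exact: agree_le tu.
  - move=> s; suff H l : exists m, exists2 t, agree k s t & forall u, agree m t u ->
      forall j, (j < l)%N -> O j u.
      have [m [t st tP]] := H k.+1; by exists m, t.
    elim: l => [|l [m [t st tP]]]; first by exists 0%N, s.
    have [oO deO] := dO l.
    have [v tv /oO[n nP]] := deO t (maxn k m).
    exists (maxn m n), v.
      by apply: agree_trans st _; apply: agree_le tv; lia.
    move=> u vu j; rewrite ltnS leq_eqVlt => /orP[/eqP ->|jl].
      by apply: nP; apply: agree_le vu; lia.
    apply: (tP u _ j jl); apply: (@agree_trans _ _ v); first by apply: agree_le tv; lia.
    by apply: agree_le vu; lia.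
exists g => h hmono hge Gh; apply: contrapT => nN.
have {nN} /choice[nx nxP] : forall N, exists n, (N <= n)%N /\ (g n < h n)%N.
  move=> N; move/forallNP/(_ N)/existsNP : nN => [n /not_implyP[Nn /negP]].
  by rewrite -ltnNge => gh; exists n.
have /choice[ext extP] : forall sk : bits * nat, exists t,
    agree (nx sk.2) sk.1 t /\ forall u, agree (g (nx sk.2)) t u ->
    forall j, (j <= nx sk.2)%N -> O j u.
  move=> [s k] /=; have [_ [t st tP]] := gP (nx k) s.
  by exists t.
(* A stage is a finite string continued by ones, with a length. The length exceeds the spliced part
   by one, so its last position [g (nx _)] carries a one. *)
pose step (sk : bits * nat) : bits * nat :=
  (splice (g (nx sk.2)) (ext sk) (fun=> true), (g (nx sk.2)).+1).
pose a n := iter n step (xpredT : bits, 0%N).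
have g_ge k : (k <= g k)%N by have [] := gP k xpredT.
have nx_ge k : (k <= nx k)%N by have [] := nxP k.
have g_lt k : (g (nx k) < h (nx k))%N by have [] := nxP k.
have agS n : agree (a n).2 (a n).1 (a n.+1).1.
  have [agn _] := extP (a n).
  move=> i ia; rewrite /= /splice ifT; last by have := g_ge (nx (a n).2); have := nx_ge (a n).2; lia.
  by apply: agn; apply: leq_trans ia _.
have szS n : ((a n).2 < (a n.+1).2)%N.
  by rewrite /=; have := g_ge (nx (a n).2); have := nx_ge (a n).2; lia.
have sz n : (n <= (a n).2)%N.
  by elim: n => // n IHn; apply: leq_ltn_trans IHn (szS n).
have ag n d : agree (a n).2 (a n).1 (a (n + d)%N).1 /\ ((a n).2 <= (a (n + d)%N).2)%N.
  elim: d => [|d [IH1 IH2]]; first by rewrite addn0.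
  rewrite addnS; split; last by have := szS (n + d)%N; lia.
  exact: agree_trans IH1 (agree_le IH2 (agS _)).
pose s : bits := fun i => (a i.+1).1 i.
have sP n : agree (a n).2 (a n).1 s.
  move=> i ia; rewrite /s; have [ni|ni] := leqP n i.+1.
    by have [+ _] := ag n (i.+1 - n)%N; rewrite subnKC// => ->.
  by have [+ _] := ag i.+1 (n - i.+1)%N; rewrite subnKC 1?ltnW// => -> //; exact: sz.
have /OG/Gh sB : (\bigcap_n O n) s.
  move=> j _; have [_ /(_ s)] := extP (a j); apply; last first.
    by apply: leq_trans (nx_ge _); exact: sz.
  apply: (@agree_trans _ _ (a j.+1).1); first exact: agree_splice.
  exact: agree_le (leqnSn _) (sP j.+1).
have tl n i : ((a n).2 <= i)%N -> (a n).1 i = true.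
  by case: n => // n /= gi; rewrite spliceE//; exact: ltnW.
(* In the new part, a position [p] below [nx] keeps the one from the earlier filling; from [nx] on,
   the one at [g (nx _)] is at most [h p], as [h] is monotone. *)
have inv n p : (p < (a n).2)%N -> exists2 q, (p <= q <= h p)%N & s q = true.
  elim: n => // n IHn /=; rewrite ltnS => pg.
  have [/IHn//|ap] := ltnP p (a n).2.
  have [pnx|nxp] := ltnP p (nx (a n).2); last first.
    exists (g (nx (a n).2)).
      by rewrite pg /=; apply: leq_trans (ltnW (g_lt _)) _; exact: hmono.
    rewrite -(sP n.+1); last by rewrite /= ltnS.
    by rewrite /= spliceE.
  exists p; first by rewrite leqnn hge.
  have [agn _] := extP (a n).
  rewrite -(sP n.+1) /=; last by lia.
  rewrite /splice ifT; last exact: leq_trans pnx (g_ge _).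
  by rewrite -agn// tl.
have [k _ kB] := sB 0%N.
have [q qk sq] := inv k.+1 k (sz k.+1).
by rewrite kB in sq.
Qed.

(** * Binary digits *)

Section Digits.
Variable R : realType.
Local Open Scope ring_scope.
Implicit Types (r q : R) (s t : bits) (k : int) (n m : nat).

(** The half-open dyadic interval of level [n] around [r] has left end [dyadic n r / 2 ^+ n], so
    [digits r] is the binary expansion of the fractional part that does not end in ones. *)
Definition dyadic n r : int := Num.floor (r * 2 ^+ n).

Definition digits r : bits := fun n => dyadic n.+1 r == 2 * dyadic n r + 1.

Fixpoint prefix k s n : int :=
  if n is m.+1 then 2 * prefix k s m + (s m)%:Z else k.

Lemma dyadicP n r k :
  dyadic n r = k <-> k%:~R <= r * 2 ^+ n < k%:~R + 1.
Proof.
by rewrite -[1]/(1%:~R) -intrD -floor_eq; split=> [/eqP//|/eqP].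
Qed.

Lemma dyadic_frac n k : dyadic n (k%:~R / 2 ^+ n) = k.
Proof.
apply/dyadicP; rewrite divfK ?lexx ?ltrDl ?ltr01//.
by rewrite expf_neq0// pnatr_eq0.
Qed.

Lemma dyadicS n r : dyadic n.+1 r = 2 * dyadic n r + (digits r n)%:Z.
Proof.
rewrite /digits; case: eqP => [->//|]; rewrite addr0.
move: (erefl (dyadic n r)) => /dyadicP; move: (dyadic n r) => k kP nE.
have /dyadicP := erefl (dyadic n.+1 r); move: (dyadic n.+1 r) nE => l /eqP lE lP.
have := kP; have := lP; rewrite exprS mulrCA; move: (r * _) => x lx kx.
have : (2 * k)%:~R < (l + 1)%:~R :> R by rewrite intrM intrD; lra.
have : l%:~R < (2 * k + 2)%:~R :> R by rewrite intrD intrM; lra.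
by rewrite !ltr_int => ? ?; lia.
Qed.

Lemma dyadic_prefix n r : dyadic n r = prefix (dyadic 0 r) (digits r) n.
Proof. by elim: n => //= n <-; exact: dyadicS. Qed.

Lemma eq_prefix k s t n : agree n s t -> prefix k s n = prefix k t n.
Proof.
elim: n => //= n IHn st; rewrite IHn ?st//.
exact: agree_le st.
Qed.

Lemma prefix_dyadic k s n r : dyadic n r = prefix k s n ->
  dyadic 0 r = k /\ agree n (digits r) s.
Proof.
elim: n => [|n IHn] //=; rewrite dyadicS => rE.
have sr : s n = digits r n by move: rE; case: (s n) (digits r n) => -[] /=; lia.
have /IHn[-> rs] : dyadic n r = prefix k s n by move: rE; rewrite sr; lia.
split=> // i; rewrite ltnS leq_eqVlt => /orP[/eqP -> //|]; exact: rs.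
Qed.

Lemma dyadic_agree n r q :
  dyadic 0 r = dyadic 0 q -> agree n (digits r) (digits q) -> dyadic n r = dyadic n q.
Proof. by move=> rq0 rq; rewrite (dyadic_prefix n r) (dyadic_prefix n q) rq0; exact: eq_prefix. Qed.

Lemma dyadic_close n r q : dyadic n r = dyadic n q -> `|r - q| < 2 ^- n.
Proof.
move=> rq; have /dyadicP := rq; have /dyadicP := erefl (dyadic n q).
have n0 : 0 < 2 ^+ n :> R by rewrite exprn_gt0.
move=> qP rP; rewrite -(ltr_pM2r n0) mulVf ?gt_eqF// -[X in `|_| * X]gtr0_norm//.
by rewrite -normrM mulrBl ltr_norml; apply/andP; split; lra.
Qed.

Lemma pow2_small (e : R) : 0 < e -> exists n, 2 ^- n < e.
Proof.
move=> e0; exists (Num.truncn e^-1).+1.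
rewrite invf_plt ?posrE ?exprn_gt0//.
apply: lt_le_trans (truncnS_gt _) _.
by rewrite -natrX ler_nat ltnW// ltn_expl.
Qed.

Lemma dyadic_subitv (a b : R) (m : nat) : a < b -> exists n k, (m <= n)%N /\
  forall r, dyadic n r = k -> a < r < b.
Proof.
move=> ab; have [n0 n0P] : exists n, 2 ^- n < (b - a) / 2 by apply: pow2_small; lra.
pose n := maxn m n0; pose k := dyadic n ((a + b) / 2).
exists n, k; split=> [|r /dyadic_close]; first exact: leq_maxl.
rewrite ltr_norml => /andP[r1 r2].
have : 2 ^- n <= 2 ^- n0 :> R.
  by rewrite lef_pV2 ?posrE ?exprn_gt0// ler_weXn2l ?leq_maxr//; lra.
move=> le0; apply/andP; split; lra.
Qed.

Lemma nowhere_denseP (N : set R) : nowhere_dense N <->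
  forall a b, a < b -> exists a' b', [/\ a <= a', a' < b', b' <= b &
    forall r, a' < r < b' -> ~ N r].
Proof.
split=> [N0 a b ab|NP].
  have [x xab nx] : exists2 x, a < x < b & ~ closure N x.
    apply: contrapT => nex.
    have : interior (closure N) ((a + b) / 2).
      have : (a + b) / 2 \in `]a, b[ by rewrite in_itv /=; apply/andP; split; lra.
      move=> /near_in_itvoo; apply: filterS => x; rewrite in_itv /= => xab.
      by apply: contrapT => nx; apply: nex; exists x.
    by rewrite N0.
  have : nbhs x (~` closure N).
    by apply: open_nbhs_nbhs; split=> //; exact/closed_openC/closed_closure.
  move=> /nbhs_ballP[e /= e0 eP].
  exists (Num.max a (x - e)), (Num.min b (x + e)); split.
  - by rewrite le_max lexx.
  - by rewrite lt_min !gt_max; apply/andP; split; apply/andP; split; lra.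
  - by rewrite ge_min lexx.
  - move=> r; rewrite gt_max lt_min => /andP[/andP[_ r1] /andP[_ r2]] Nr.
    apply: (eP r); last exact: subset_closure.
    by rewrite /ball /= ltr_norml; apply/andP; split; lra.
apply/seteqP; split=> // x /nbhs_ballP[e /= e0 eP].
have [|a [b [a1 ab b1 nN]]] := NP (x - e) (x + e); first lra.
have yc : closure N ((a + b) / 2).
  by apply: eP; rewrite /ball /= ltr_norml; apply/andP; split; lra.
have [|r [Nr rab]] := yc `]a, b[%classic.
  by apply: near_in_itvoo; rewrite in_itv /=; lra.
by apply: (nN r).
Qed.

(** Every interval contains a dyadic one, and continuing its digits into [O] gives a dyadic
    subinterval free of the set. *)
Lemma nowhere_dense_digitsC (O : set bits) :
  dense_open O -> nowhere_dense [set r | ~ O (digits r)].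
Proof.
move=> [oO dO]; apply/nowhere_denseP => a b ab.
have [n [k [_ nk]]] := dyadic_subitv 0 ab.
pose r0 : R := k%:~R / 2 ^+ n.
have [t tr0 /oO[m0 mP]] := dO (digits r0) n.
pose m := maxn n m0; pose l := prefix (dyadic 0 r0) t m.
have key r : dyadic m r = l -> a < r < b /\ O (digits r).
  move=> /prefix_dyadic[r0E rt]; split.
    apply: nk; rewrite -(dyadic_frac n k); apply: dyadic_agree => //.
    apply: agree_trans (agree_sym tr0); apply: agree_le rt; exact: leq_maxl.
  by apply/mP/agree_sym; apply: agree_le rt; exact: leq_maxr.
have m0' : 0 < 2 ^+ m :> R by rewrite exprn_gt0.
exists (l%:~R / 2 ^+ m), ((l%:~R + 1) / 2 ^+ m).
have itv r : l%:~R / 2 ^+ m <= r < (l%:~R + 1) / 2 ^+ m -> dyadic m r = l.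
  by rewrite ler_pdivrMr// ltr_pdivlMr// => rP; apply/dyadicP.
have lt01 : l%:~R / 2 ^+ m < (l%:~R + 1) / 2 ^+ m :> R.
  by rewrite ltr_pM2r ?invr_gt0//; lra.
split=> //.
- by have [|+ _] := key (l%:~R / 2 ^+ m); [apply: itv; rewrite lexx|lra].
- rewrite leNgt; apply/negP => bl.
  have [|+ _] := key (Num.max b (l%:~R / 2 ^+ m)).
    by apply: itv; rewrite le_max lexx orbT /= gt_max bl.
  by move=> /andP[_]; rewrite gt_max ltxx.
- move=> r /andP[r1 r2]; apply; have [|_ //] := key r.
  by apply: itv; rewrite r2 ltW.
Qed.

(** The condition [dyadic 0 r = 0] places [r] in the half-open unit interval, on which [digits] is
    injective. *)
Definition dense_open_prefix (N : set R) : set bits :=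
  [set s | exists m, forall r, dyadic 0 r = 0 -> agree m (digits r) s -> ~ N r].

Lemma dense_open_prefixP N : nowhere_dense N -> dense_open (dense_open_prefix N).
Proof.
move=> /nowhere_denseP NP; split=> [s [m mP]|s n].
  exists m => t st; exists m => r r0 rt; apply: mP => //.
  exact: agree_trans rt (agree_sym st).
pose k := prefix 0 s n.
have n0 : 0 < 2 ^+ n :> R by rewrite exprn_gt0.
have [|a [b [a1 ab b1 nN]]] := NP (k%:~R / 2 ^+ n) ((k%:~R + 1) / 2 ^+ n).
  by rewrite ltr_pM2r ?invr_gt0//; lra.
have [m [l [nm ml]]] := dyadic_subitv n ab.
pose r0 : R := l%:~R / 2 ^+ m.
have /andP[r0a r0b] := ml _ (dyadic_frac m l).
have [r00 sr0] : dyadic 0 r0 = 0 /\ agree n (digits r0) s.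
  apply: prefix_dyadic; apply/dyadicP.
  rewrite -ler_pdivrMr// -ltr_pdivlMr//; apply/andP; split.
    exact: le_trans a1 (ltW r0a).
  exact: lt_le_trans r0b b1.
exists (digits r0); first exact: agree_sym.
exists m => r rz rr0 /=; apply: nN; apply: ml.
by rewrite -(dyadic_frac m l); apply: dyadic_agree => //; rewrite rz.
Qed.

(** The real is the supremum of the left ends of nested intervals. Each zero digit strictly lowers
    the right end, which keeps the supremum inside the half-open intervals. *)
Lemma digits_surj s : (forall n, exists2 i, (n <= i)%N & s i = false) ->
  exists2 r, dyadic 0 r = 0 & digits r = s.
Proof.
move=> sinf.
have n0 n : 0 < 2 ^+ n :> R by rewrite exprn_gt0.
pose lo n : R := (prefix 0 s n)%:~R / 2 ^+ n.
pose hi n : R := ((prefix 0 s n)%:~R + 1) / 2 ^+ n.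
have u0 n : 0 < 2 ^- n :> R by rewrite invr_gt0.
have uS n : 2 ^- n.+1 = 2 ^- n / 2 :> R by rewrite exprSr invfM mulrC.
have hiE n : hi n = lo n + 2 ^- n by rewrite /hi /lo mulrDl mul1r.
have loE n : lo n.+1 = lo n + (if s n then 2 ^- n / 2 else 0).
  rewrite /lo /= uS intrD intrM mulrDl; case: (s n); rewrite ?mul0r ?mul1r; first by field; rewrite gt_eqF.
  by field; rewrite gt_eqF.
have loS n : lo n <= lo n.+1 by rewrite loE; have := u0 n; case: (s n); lra.
have hiS n : hi n.+1 <= hi n.
  by rewrite !hiE loE uS; have := u0 n; case: (s n); lra.
have hiS0 n : s n = false -> hi n.+1 < hi n.
  by move=> sn; rewrite !hiE loE uS sn; have := u0 n; lra.
have lohi n : lo n < hi n by rewrite ltr_pM2r ?invr_gt0//; lra.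
have lole m n : (m <= n)%N -> lo m <= lo n by move=> mn; exact: (homo_leq (@lexx _ R) (@le_trans _ R)).
have hile m n : (m <= n)%N -> hi n <= hi m.
  move=> mn; rewrite -(subnKC mn); elim: (n - m)%N => [|d IHd]; first by rewrite addn0.
  by rewrite addnS; exact: le_trans (hiS _) IHd.
have ub n : ubound (range lo) (hi n).
  move=> _ [m _ <-]; apply: (@le_trans _ _ (lo (maxn m n))); first exact/lole/leq_maxl.
  by apply: le_trans (ltW (lohi _)) _; exact/hile/leq_maxr.
have hs : has_sup (range lo) by split; [exists (lo 0%N), 0%N|exists (hi 0%N)].
pose r := sup (range lo).
have rn n : dyadic n r = prefix 0 s n.
  apply/dyadicP; rewrite -ler_pdivrMr// -ltr_pdivlMr//; apply/andP; split.
    by apply: sup_upper_bound => //; exists n.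
  have [m nm sm] := sinf n.
  apply: (@le_lt_trans _ _ (hi m.+1)); first by apply: ge_sup => //; case: hs.
  by apply: lt_le_trans (hiS0 _ sm) (hile _ _ nm).
exists r; first exact: rn 0%N.
apply/funext => n; have [_] := prefix_dyadic (rn n.+1); exact.
Qed.

(** Infinitely many ones exclude a dyadic rational, so [r] is interior to all its dyadic
    intervals. *)
Lemma digits_continuous r n : (forall m, exists2 i, (m <= i)%N & digits r i = true) ->
  exists2 e : R, 0 < e & forall q, `|r - q| < e -> dyadic n q = dyadic n r.
Proof.
move=> rinf; have n0 : 0 < 2 ^+ n :> R by rewrite exprn_gt0.
have /dyadicP := erefl (dyadic n r); set k := dyadic n r => /andP[kr rk].
have {}kr : k%:~R < r * 2 ^+ n.
  rewrite lt_neqAle kr andbT; apply/eqP => rE.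
  have {}rE : r = k%:~R / 2 ^+ n by rewrite rE mulfK ?gt_eqF.
  have [m nm] := rinf n; rewrite /digits.
  have dE l : (n <= l)%N -> dyadic l r = k * 2 ^+ (l - n).
    move=> nl; have lE : 2 ^+ l = 2 ^+ n * 2 ^+ (l - n) :> R by rewrite -exprD subnKC.
    apply/dyadicP; rewrite rE lE mulrA divfK ?gt_eqF//.
    by rewrite intrM rmorphXn /= -[2%:~R]/(2 : R) lexx ltrDl ltr01.
  rewrite !dE//; last exact: leqW.
  by rewrite subSn// exprS => /eqP; lia.
exists (Num.min (r - k%:~R / 2 ^+ n) ((k%:~R + 1) / 2 ^+ n - r)).
  by rewrite lt_min !subr_gt0 ltr_pdivrMr// ltr_pdivlMr// kr.
move=> q; rewrite lt_min => /andP[]; rewrite !ltr_norml => /andP[q1 q2] /andP[q3 q4].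
by apply/dyadicP; rewrite -ler_pdivrMr// -ltr_pdivlMr//; lra.
Qed.

End Digits.

(** * Transfer of category between the real line and the Cantor space *)

Section Transfer.
Variable R : realType.

Lemma meager_digitsC (G : set bits) : comeager G ->
  exists2 M : set R, meager M & forall r, ~ M r -> G (digits r).
Proof.
move=> [O dO OG]; exists (\bigcup_n [set r | ~ O n (digits r)]).
  by exists (fun n => [set r | ~ O n (digits r)]) => // n; exact: nowhere_dense_digitsC.
by move=> r nM; apply: OG => n _; apply: contrapT => nO; apply: nM; exists n.
Qed.

Lemma comeager_of_meager (M : set R) : meager M ->
  comeager [set s | exists r, [/\ dyadic 0 r = 0, digits r = s & ~ M r]].
Proof.
move=> [N nN ->].
apply: sub_comeager (comeagerI (comeager_infinite false)
  (comeager_forall (fun n => dense_open_comeager (dense_open_prefixP (nN n))))).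
move=> s [sinf sN]; have [r r0 rs] := digits_surj R sinf.
exists r; split=> // -[n _ Nr]; have [m /(_ r r0)] := sN n.
by rewrite rs => /(_ (@agree_refl m s)).
Qed.

(** The Baire category theorem, applied to the complements of the closures of the nowhere dense
    pieces of a countable cover. *)
Lemma meager_cover_uncountable (K : set (set R)) : meager_cover K -> small K [set: nat].
Proof.
move=> [Km Kcov]; apply/smallP => -[g Kg].
have gm n : meager (if `[< K (g n) >] then g n else set0).
  case: asboolP => [/Km//|_]; exists (fun=> set0); last by rewrite bigcup_const.
  by move=> _; rewrite /nowhere_dense closure0 interior0.
have /choice[N NP] : forall n, exists N : nat -> set R,
    (forall m, nowhere_dense (N m)) /\
    (if `[< K (g n) >] then g n else set0) = \bigcup_m N m.
  by move=> n; have [N] := gm n; exists N.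
pose F i := if unpickle i is Some (n, m) then ~` closure (N n m) else setT.
have dF : dense (\bigcap_n F n).
  apply: (@Baire R R^o) => i; rewrite /F; case: (unpickle i) => [[n m]|]; last first.
    by split; [exact: openT|move=> O [x Ox] _; exists x].
  split; first exact/closed_openC/closed_closure.
  move=> O [x Ox] oO; apply: contrapT => /set0P/negP; rewrite negbK => /eqP OE.
  have [/(_ m) N0 _] := NP n.
  suff : interior (closure (N n m)) x by rewrite N0.
  apply: (@filterS _ _ _ O); last exact: open_nbhs_nbhs.
  move=> y Oy; apply: contrapT => ny.
  by have : (O `&` ~` closure (N n m)) y by []; rewrite OE.
have [|x [_ Fx]] := dF setT _ openT; first by exists 0%R.
have [A KA Ax] : (\bigcup_(A in K) A) x by rewrite Kcov.
have [n _ gn] := Kg _ KA; subst A.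
have [_] := NP n; rewrite (asboolT KA) => gE.
move: Ax; rewrite gE => -[m _ Nx].
have := Fx (pickle (n, m)) I; rewrite /F pickleK; apply.
exact: subset_closure.
Qed.

(** Otherwise the meager sets of reals outside which [digits] falls into the [G j] would cover the
    line, with fewer than cov(M) members. *)
Lemma cov_common (K : set (set R)) J (A : set J) (G : J -> set bits) :
  has_card_cov K -> small K A -> (forall j, A j -> comeager (G j)) ->
  exists s, forall j, A j -> G j s.
Proof.
move=> [_ Kleast] sA cG; apply: contrapT => nex.
have /choice[M MP] : forall j, exists M : set R, A j ->
    meager M /\ forall r, ~ M r -> G j (digits r).
  move=> j; have [/cG/meager_digitsC[M mM MG]|nA] := pselect (A j); first by exists M.
  by exists set0.
have sM : small K (M @` A) by apply: (small_image (g := M) sA).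
move/small_card_le : sM; apply; apply: Kleast; split.
  by move=> _ [j /MP[mM _] <-].
apply/seteqP; split=> // r _; apply: contrapT => nr.
apply: nex; exists (digits r) => j Aj; have [_] := MP _ Aj; apply => Mr.
by apply: nr; exists (M j) => //; exists j.
Qed.

(** As [I] maps onto [L], it can index a cofinal family; the empty set serves indices that are not
    sent into [L]. *)
Lemma cof_cofinal (L : set (set R)) (I : Type) :
  has_card_cof L -> ~ small L [set: I] ->
  exists2 G : I -> set bits, forall a, comeager (G a) &
    forall H, comeager H -> exists a, G a `<=` H.
Proof.
move=> [[Lm Lcof] _] /negP/smallP/contrapT[g Lg].
pose B a := if `[< L (g a) >] then g a else set0.
have mB a : meager (B a).
  rewrite /B; case: asboolP => [/Lm//|_]; exists (fun=> set0).
    by move=> _; rewrite /nowhere_dense closure0 interior0.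
  by rewrite bigcup_const.
exists (fun a => [set s | exists r, [/\ dyadic 0 r = 0%R, digits r = s & ~ B a r]]).
  by move=> a; exact: comeager_of_meager.
move=> H /meager_digitsC[M /Lcof[C LC MC] MH].
have [a _ ga] := Lg _ LC; exists a => s [r [_ <- nB]]; apply: MH => Mr.
by apply: nB; rewrite /B ga (asboolT LC); exact: MC.
Qed.

End Transfer.

(** * Generic sequences *)

(** Recursion in which stage [a] sees only earlier values; since [P a] depends on nothing else, [v0]
    can stand for the rest. *)
Lemma wf_choice (I V : Type) (lt : I -> I -> Prop) (P : I -> (I -> V) -> V -> Prop) :
  V -> well_founded lt ->
  (forall a f f' v, (forall b, lt b a -> f b = f' b) -> P a f v -> P a f' v) ->
  (forall a f, exists v, P a f v) -> exists f, forall a, P a f (f a).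
Proof.
move=> v0 wf Pext Pex.
have /choice[c cP] : forall af : I * (I -> V), exists v, P af.1 af.2 v.
  by move=> [a f]; exact: Pex.
pose step a (rec : forall b, lt b a -> V) :=
  c (a, fun b => if pselect (lt b a) is left ba then rec b ba else v0).
pose f := Fix wf (fun=> V) step.
exists f => a.
have -> : f a = step a (fun b _ => f b).
  apply: (Fix_eq wf (fun=> V) step) => {}a g g' gg'.
  congr (c (a, _)); apply/funext => b; case: pselect => // ba; exact: gg'.
apply: Pext (cP (a, _)) => b ba /=.
by case: pselect.
Qed.

(** The points of [l] fill the first coordinates and [s] encodes all later ones, so every finite
    dimension is treated within the one space [bits]. *)
Definition sections (G : set bits) (l : seq bits) : set bits :=
  [set s | G (foldr cons_bits s l)].

Lemma sections_rcons G l v :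
  sections G (rcons l v) = [set s | sections G l (cons_bits v s)].
Proof. by rewrite /sections; apply/funext => s /=; rewrite foldr_rcons. Qed.

Lemma comeager_sections_rcons G l : comeager (sections G l) ->
  comeager [set v | comeager (sections G (rcons l v))].
Proof.
move=> /comeager_section; apply: sub_comeager => v /=.
by rewrite sections_rcons.
Qed.

Definition component k (z : bits) : bits := head_bits (iter k tail_bits z).

Lemma component_foldr s0 s l k : (k < size l)%N ->
  component k (foldr cons_bits s l) = nth s0 l k.
Proof.
rewrite /component; elim: l k => // v l IHl [|k] kl; first by rewrite /= head_cons.
by rewrite iterSr /= tail_cons IHl.
Qed.

Lemma agree_component k n : exists N, forall z z', agree N z z' ->
  agree n (component k z) (component k z').
Proof.
suff [N NP] : exists N, forall z z', agree N z z' ->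
    agree n.*2 (iter k tail_bits z) (iter k tail_bits z').
  by exists N => z z' /NP; exact: agree_head.
elim: k => [|k [N NP]]; first by exists n.*2.
exists N.*2 => z z' /agree_tail/NP; by rewrite !iterSr.
Qed.

Lemma agree_foldr_component n m (z : bits) (v : nat -> bits) :
  (forall k, (k < m)%N -> agree n (component k z) (v k)) ->
  agree n z (foldr cons_bits (iter m tail_bits z) (mkseq v m)).
Proof.
elim: m z v => // m IHm z v zv; rewrite iterSr /mkseq /=.
rewrite -[in X in agree _ X](cons_head_tail z); apply: agree_cons; first exact: (zv 0%N).
rewrite (iotaDl 1 0 m : iota 1 m = _) -map_comp; apply: (IHm (tail_bits z) (v \o addn 1)) => k km.
by have := zv k.+1 km; rewrite /component iterSr.
Qed.

Definition open_bits (V : set bits) : Prop :=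
  forall s, V s -> exists n, forall t, agree n s t -> V t.

(* The selection principle S_1(Omega, Omega), for every subset of the range of [x]. *)
Definition omega_selective (I : choiceType) (x : I -> bits) : Prop :=
  forall (A : set I) (U : nat -> set (set bits)),
  (forall n V, U n V -> open_bits V) ->
  (forall n (l : seq I), {in l, forall i, A i} ->
    exists2 V, U n V & {in l, forall i, V (x i)}) ->
  exists2 V : nat -> set bits, forall n, U n (V n) &
    forall l : seq I, {in l, forall i, A i} -> exists n, {in l, forall i, V n (x i)}.

Section Generic.
Variables (T : pointedType) (K : set T).
Hypothesis Kreg : regular_card K.
Hypothesis Kunc : small K [set: nat].
Variables (I : choiceType) (lt : I -> I -> Prop).
Hypothesis lt_wf : well_founded lt.
Hypothesis lt_trans : forall a b c, lt a b -> lt b c -> lt a c.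
Hypothesis lt_total : forall a b, [\/ lt a b, a = b | lt b a].
Hypothesis lt_small : forall a, small K [set b | lt b a].
Hypothesis I_large : ~ small K [set: I].
Hypothesis common : forall J (A : set J) (G : J -> set bits), small K A ->
  (forall j, A j -> comeager (G j)) -> exists s, forall j, A j -> G j s.
Variable G : I -> set bits.
Hypothesis comeagerG : forall a, comeager (G a).
Hypothesis cofinalG : forall H, comeager H -> exists a, G a `<=` H.

(* A point avoids the meager sets obtained from the earlier members of the cofinal family by fixing
   some coordinates at earlier points, so that increasing tuples of points behave as Cohen reals. *)
Definition generic (x : I -> bits) : Prop := forall a b l,
  lt b a -> {in l, forall c, lt c a} -> comeager (sections (G b) (map x l)) ->
  comeager (sections (G b) (rcons (map x l) (x a))).

Definition nonzero_rows : set bits := [set s | forall n, exists j, s (code n j)].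

(** Infinitely many zeros make the sequence the digits of a real; infinitely many ones make [digits]
    continuous at that real. *)
Definition balanced : set bits :=
  [set s | forall b n, exists2 i, (n <= i)%N & s i = b].

Lemma comeager_nonempty H : comeager H -> exists s, H s.
Proof.
move=> cH; have [|//|s] := @common unit setT (fun=> H).
  by apply: (small_image (g := fun=> tt) Kunc) => -[] _; exists 0%N.
by move=> /(_ tt Logic.I); exists s.
Qed.

(** Stage [a] imposes fewer than |[K]| comeager conditions, indexed by an earlier index and a finite
    list of earlier indices; [common] meets them all. *)
Lemma exists_generic_pair (t : I -> bits) : (forall a, nonzero_rows (t a)) ->
  exists x y : I -> bits,
  [/\ generic x, generic y, injective x,
      forall a b, nonzero_rows (xor (x a) (y b)) &
      forall a, [/\ y a = xor (x a) (t a), balanced (x a) & balanced (y a)]].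
Proof.
move=> t_rows.
pose sh (f : I -> bits) a := xor (f a) (t a).
pose C1 (f : I -> bits) (p : I * seq I) (v : bits) :=
  comeager (sections (G p.1) (map f p.2)) -> comeager (sections (G p.1) (rcons (map f p.2) v)).
(* New [x] against old [y], new [y] against old [x], and new [x] against old [x]; the last gives
   injectivity. *)
pose C3 a (f : I -> bits) b v := [/\ nonzero_rows (xor v (sh f b)),
  nonzero_rows (xor (xor v (t a)) (f b)) & nonzero_rows (xor v (f b))].
pose C4 a v := balanced v /\ balanced (xor v (t a)).
pose P a (f : I -> bits) v := [/\ C4 a v, forall b, lt b a -> C3 a f b v,
  forall b (l : seq I), lt b a -> {in l, forall c, lt c a} -> C1 f (b, l) v &
  forall b (l : seq I), lt b a -> {in l, forall c, lt c a} -> C1 (sh f) (b, l) (xor v (t a))].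
have [|a f|x xP] := @wf_choice I bits lt P xpredT lt_wf.
- move=> a f f' v ff' [p4 p3 p1 p2]; split=> // [b ba|b l ba la|b l ba la].
  + by have := p3 b ba; rewrite /C3 /sh ff'.
  + have -> : C1 f' (b, l) = C1 f (b, l); last exact: p1.
    rewrite /C1 /=; have -> // : map f' l = map f l.
    by apply/eq_in_map => c /la/ff'.
  + have -> : C1 (sh f') (b, l) = C1 (sh f) (b, l); last exact: p2.
    rewrite /C1 /=; have -> // : map (sh f') l = map (sh f) l.
    by apply/eq_in_map => c /la/ff'; rewrite /sh => ->.
(* [None] carries the conditions on the new point alone, which must hold even when no index lies
   below [a]. *)
- pose A := [set None] `|` some @` [set p : I * seq I | lt p.1 a /\ {in p.2, forall c, lt c a}].
  pose H (o : option (I * seq I)) : set bits := if o is Some p then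
    [set v | C3 a f p.1 v] `&` ([set v | C1 f p v] `&` [set v | C1 (sh f) p (xor v (t a))])
    else C4 a.
  have rows u : comeager [set v | nonzero_rows (xor v u)] by exact/comeager_xor/comeager_rows.
  have cC1 g p : comeager [set v | C1 g p v].
    have [cg|ncg] := pselect (comeager (sections (G p.1) (map g p.2))).
      by apply: sub_comeager (comeager_sections_rcons cg) => v cv _.
    apply: (@sub_comeager setT) => [v _ /ncg //|].
    by apply: dense_open_comeager; split=> [s _|s n]; [exists 0%N|exists s].
  have cbal : comeager balanced by apply: comeager_forall => b; exact: comeager_infinite.
  have [||v vP] := @common _ A H.
  + apply: smallU => //; first exact: small1.
    have sX := smallX Kreg (lt_small a) (small_seq Kreg Kunc (lt_small a)).
    apply: (small_image (g := Some) sX).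
    by move=> _ [[b l] [/= ba la] <-]; exists (b, l).
  + move=> [p|] _ /=; last by apply: comeagerI => //; exact: comeager_xor.
    apply: comeagerI; last by apply: comeagerI => //; exact: (@comeager_xor (t a) [set v | C1 (sh f) p v]).
    apply: (@sub_comeager ([set v | nonzero_rows (xor v (sh f p.1))] `&`
      ([set v | nonzero_rows (xor (xor v (t a)) (f p.1))] `&` [set v | nonzero_rows (xor v (f p.1))]))).
      by move=> v [? [? ?]].
    apply: comeagerI => //; apply: comeagerI => //.
    exact: (@comeager_xor (t a) [set v | nonzero_rows (xor v (f p.1))]).
  + exists v; split.
    * by have := vP None; apply; left.
    * move=> b ba; have [] // := vP (Some (b, [::])).
      by right; exists (b, [::]).
    * move=> b l ba la; have [|_ []//] := vP (Some (b, l)).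
      by right; exists (b, l).
    * move=> b l ba la; have [|_ []//] := vP (Some (b, l)).
      by right; exists (b, l).
- exists x, (sh x); split.
  + by move=> a b l ba la; have [_ _ + _] := xP a; exact.
  + by move=> a b l ba la; have [_ _ _ +] := xP a; exact.
  + have nlt a b : lt b a -> x a <> x b.
      move=> ba xab; have [_ /(_ b ba)[_ _]] := xP a.
      by move=> + _ _; rewrite xab => /(_ 0%N)[j]; rewrite /xor addbb.
    by move=> a b xab; have [/nlt|//|/nlt] := lt_total a b; rewrite xab.
  + move=> a b; have [ab|->|ba] := lt_total a b.
    * have [_ /(_ a ab)[_ h _] _ _] := xP b => n; have [j hj] := h n.
      by exists j; move: hj; rewrite /xor addbC.
    * move=> n; have [j tj] := t_rows b n; exists j.
      by rewrite /sh /xor addbA addbb.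
    * by have [_ /(_ b ba)[h _ _]] := xP a.
  + by move=> a; have [[? ?] _ _ _] := xP a; split.
Qed.

Lemma cofinal_dominating : exists g : I -> nat -> nat,
  forall h : nat -> nat, exists a N, forall n, (N <= n)%N -> (h n <= g a n)%N.
Proof.
have /choice[g gP] := fun a => comeager_dominating (comeagerG a).
exists g => h.
pose h' n := (n + \max_(i < n.+1) h i)%N.
have [a aP] := cofinalG (comeager_zero_blocks h').
have [|n|//|N NP] := gP a h'.
- move=> m n mn; rewrite leq_add//; apply/bigmax_leqP => i _.
  have im : (i < n.+1)%N by apply: leq_trans (ltn_ord i) _.
  exact: (leq_bigmax (F := fun i : 'I_n.+1 => h i) (Ordinal im)).
- exact: leq_addr.
exists a, N => n /NP; apply: leq_trans; apply: leq_trans (leq_addl _ _).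
exact: (leq_bigmax (F := fun i : 'I_n.+1 => h i) ord_max).
Qed.

(** A sequence [s] encodes the selection of the first one in each row. For a given tuple it succeeds
    on a dense open set, since a finite string leaves some row untouched; [common] handles all
    tuples in [F]. *)
Lemma small_select (W : nat -> nat -> set bits) (x : I -> bits) (F : set (seq I)) :
  small K F ->
  (forall l n, F l -> exists j, {in l, forall i, W n j (x i)}) ->
  exists f : nat -> nat, forall l, F l -> exists n, {in l, forall i, W n (f n) (x i)}.
Proof.
move=> sF WF.
have [|s sP] := @common _ F (fun l => [set s : bits | exists n j, [/\ s (code n j),
    forall j', (j' < j)%N -> ~~ s (code n j') & {in l, forall i, W n j (x i)}]]) sF.
  move=> l Fl; apply: dense_open_comeager; split.
    move=> s [n [j [sj sj' lW]]].
    exists (\max_(j' < j.+1) code n j').+1 => t st; exists n, j.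
    have le j' : (j' <= j)%N -> (code n j' < (\max_(j' < j.+1) code n j').+1)%N.
      move=> jj; rewrite ltnS; have jj' : (j' < j.+1)%N by [].
      exact: (leq_bigmax (F := fun i : 'I_j.+1 => code n i) (Ordinal jj')).
    split=> //; first by rewrite -st// le.
    by move=> j' jj; rewrite -st ?sj'// le// ltnW.
  move=> s m; have [n nP] := code_large m; have [j jP] := WF l n Fl.
  exists (splice m s (of_rows (fun _ j' => j' == j))); first exact: agree_splice.
  exists n, j; split=> //; rewrite ?spliceE ?of_rowsE//.
  by move=> j' jj; rewrite spliceE// of_rowsE ltn_eqF.
pose f n := if pselect (exists j, s (code n j)) is left p then ex_minn p else 0%N.
exists f => l /sP[n [j [sj sj' lW]]]; exists n.
suff -> : f n = j by [].
rewrite /f; case: pselect => [p|]; last by case; exists j.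
case: ex_minnP => k sk kmin; apply/eqP; rewrite eqn_leq kmin//= leqNgt.
by apply/negP => /sj'; rewrite sk.
Qed.

Let ltb a b := `[< lt a b >].

(** Genericity adjoins the coordinates one at a time from the smallest up, starting from the
    comeager set [G b]. *)
Lemma generic_increasing x b l : generic x -> pairwise ltb (b :: l) ->
  comeager (sections (G b) (map x l)).
Proof.
move=> gx; elim/last_ind: l => [_|l a IHl]; first exact: comeagerG.
rewrite pairwise_cons all_rcons pairwise_rcons => /andP[/andP[/asboolP ba bl] /andP[la pl]].
rewrite map_rcons; apply: gx => //.
  by move=> c /(allP la)/asboolP.
by apply: IHl; rewrite pairwise_cons bl pl.
Qed.

Lemma countable_dense x (A : set I) : A !=set0 -> exists d : seq bool -> I,
  (forall w, A (d w)) /\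
  forall i n, A i -> agree n (x i) (x (d (mkseq (x i) n))).
Proof.
move=> [i0 Ai0].
have /choice[d dP] : forall w, exists i, A i /\
    forall j, A j -> agree (size w) (nth false w) (x j) -> agree (size w) (nth false w) (x i).
  move=> w; have [[i [Ai wi]]|nw] := pselect (exists i, A i /\ agree (size w) (nth false w) (x i)).
    by exists i.
  by exists i0; split=> // j Aj wj; exfalso; apply: nw; exists j.
exists d; split=> [w|i n Ai]; first by have [] := dP w.
have [_ /(_ i Ai)] := dP (mkseq (x i) n); rewrite size_mkseq => h.
apply: agree_trans (@agree_mkseq (x i) n) _; apply: h.
exact/agree_sym/agree_mkseq.
Qed.

(* The even covers take care of [l ++ q] for tuples [q] from a countable dense set, hence of all
   increasing tuples above some [c]; the other tuples start with one of fewer than |K| points. *)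
Lemma increasing_select x (A : set I) (m : nat) : generic x ->
  forall (W : nat -> nat -> set bits) (F : set (seq I)),
  (forall n j, open_bits (W n j)) ->
  (forall n (l : seq I), {in l, forall i, A i} -> exists j, {in l, forall i, W n j (x i)}) ->
  small K F -> (forall l, F l -> {in l, forall i, A i}) ->
  exists f : nat -> nat, forall l p, F l -> size p = m -> pairwise ltb p ->
    {in p, forall i, A i} -> exists n, {in l ++ p, forall i, W n (f n) (x i)}.
Proof.
move=> gx; elim: m => [|m IHm] W F oW cW sF FA.
  have [|f fP] := @small_select W x F sF; first by move=> l n /FA; exact: cW.
  by exists f => l p Fl /size0nil -> _ _; rewrite cats0; exact: fP.
have [A0|nA] := pselect (A !=set0); last first.
  exists (fun=> 0%N) => l [//|i p] _ _ _ pA; exfalso; apply: nA; exists i.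
  by apply: pA; rewrite mem_head.
have [d [dA dP]] := countable_dense x A0.
pose F1 := [set lw.1 ++ map d lw.2 | lw in F `*` [set: seq (seq bool)]].
have sW : small K [set: seq (seq bool)].
  apply: (small_image (g := fun n => odflt [::] (unpickle n)) Kunc) => w _.
  by exists (pickle w) => //; rewrite pickleK.
have [||f1 f1P] := @small_select (fun n => W n.*2) x F1.
- exact: (small_image (smallX Kreg sF sW) (g := fun lw => lw.1 ++ map d lw.2)).
- move=> _ n [[l ws] [/= Fl _] <-]; apply: cW => i; rewrite mem_cat => /orP[/(FA _ Fl)//|].
  by move=> /mapP[w _ ->].
pose V n := W n.*2 (f1 n).
(* The second alternative, a coordinate away from all points of [A], makes the set dense in the
   whole space; tuples from [A] never satisfy it. *)
pose GT (l : seq I) : set bits := [set z |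
  (exists n, {in l, forall i, V n (x i)} /\ forall k, (k < m.+1)%N -> V n (component k z)) \/
  exists k n, (k < m.+1)%N /\ forall i, A i -> ~ agree n (component k z) (x i)].
have dGT l : F l -> dense_open (GT l).
  move=> Fl; split.
    move=> z [[n [lV zV]]|[k [n [km kP]]]]; last first.
      have [N NP] := agree_component k n.
      exists N => z' zz'; right; exists k, n; split=> // i Ai ag; apply: (kP i Ai).
      exact: agree_trans (NP _ _ zz') ag.
    suff [N NP] : exists N, forall z', agree N z z' ->
        forall k, (k < m.+1)%N -> V n (component k z').
      by exists N => z' zz'; left; exists n; split=> //; exact: NP.
    elim: (m.+1) zV => [_|k IHk zV]; first by exists 0%N.
    have [|N NP] := IHk; first by move=> k' kk; apply/zV/ltnW.
    have [n' nP] := oW _ _ _ (zV k (ltnSn k)).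
    have [N' NP'] := agree_component k n'.
    exists (maxn N N') => z' zz' k'; rewrite ltnS leq_eqVlt => /orP[/eqP ->|].
      by apply/nP/NP'; apply: agree_le zz'; exact: leq_maxr.
    by apply: NP; apply: agree_le zz'; exact: leq_maxl.
  move=> z n; have [[k [km kP]]|nk] := pselect (exists k, (k < m.+1)%N /\
      forall i, A i -> ~ agree n (component k z) (x i)).
    by exists z => //; right; exists k, n.
  have /choice[c cP] : forall k, exists i, A i /\ ((k < m.+1)%N -> agree n (component k z) (x i)).
    move=> k; have [km|mk] := ltnP k m.+1; last by have [i Ai] := A0; exists i.
    apply: contrapT => nki; apply: nk; exists k; split=> // i Ai zi.
    by apply: nki; exists i.
  pose v k := x (d (mkseq (x (c k)) n)).
  exists (foldr cons_bits (iter m.+1 tail_bits z) (mkseq v m.+1)).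
    apply: agree_foldr_component => k km; have [Ac /(_ km) zc] := cP k.
    exact: agree_trans zc (dP _ _ Ac).
  left; have [|N NP] := f1P (l ++ map d (mkseq (fun k => mkseq (x (c k)) n) m.+1)).
    by eexists (l, _).
  exists N; split=> [i il|k km].
    by apply: NP; rewrite mem_cat il.
  rewrite (component_foldr xpredT) ?size_mkseq// nth_mkseq//.
  apply: NP; rewrite mem_cat; apply/orP; right; apply/map_f.
  by apply/mapP; exists k => //; rewrite mem_iota.
(* By genericity an increasing tuple above [a l] extends to a point of [G (a l)], hence of
   [GT l]. *)
have /choice[a aP] : forall l, exists a, F l -> G a `<=` GT l.
  move=> l; have [Fl|nFl] := pselect (F l); last by have [i _] := A0; exists i.
  by have [a aP] := cofinalG (dense_open_comeager (dGT l Fl)); exists a.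
have [c cP] := small_bounded Kreg Kunc lt_total lt_small I_large
  (small_image (g := a) sF (@subset_refl _ _)).
(* A first entry below [c] joins the fixed part, which stays small, and leaves a tuple of length [m]
   to the induction hypothesis. *)
pose F2 := [set b :: l | b in [set b | lt b c /\ A b] & l in F].
have [||||f2 f2P] := IHm (fun n => W n.*2.+1) F2.
- by move=> n j; exact: oW.
- by move=> n l; exact: cW.
- apply: (small_image (smallX Kreg (lt_small c) sF) (g := fun bl => bl.1 :: bl.2)).
  by move=> _ [b [bc _] [l Fl <-]]; exists (b, l).
- move=> _ [b [_ Ab] [l Fl <-]] i; rewrite inE => /predU1P[-> //|]; exact: FA.
exists (fun n => if odd n then f2 n./2 else f1 n./2) => l p Fl sp inc pA.
case: p => [//|b p] in sp inc pA *.
have Ab : A b by apply: pA; rewrite mem_head.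
have [bc|cb] := pselect (lt b c).
  have [||||n nP] := f2P (b :: l) p.
  - by exists b => //; exists l.
  - by case: sp.
  - by move: inc; rewrite pairwise_cons => /andP[].
  - by move=> i ip; apply: pA; rewrite inE ip orbT.
  exists n.*2.+1 => i il; rewrite /= odd_double /= uphalf_double; apply: nP.
  by move: il; rewrite !mem_cat !inE; case: (i == b) => //=; rewrite orbT.
have ac : lt (a l) c by apply: cP; exists l.
have ab : lt (a l) b by have [/cb//|->//|] := lt_total b c; exact: lt_trans.
have [|s /(aP l Fl) sGT] := comeager_nonempty (@generic_increasing x (a l) (b :: p) gx _).
  rewrite pairwise_cons inc andbT; apply/allP => i; rewrite inE => /predU1P[->|ip].
    exact/asboolP.
  apply/asboolP; apply: (lt_trans ab); apply/asboolP.
  by move: inc; rewrite pairwise_cons => /andP[/allP h _]; exact: h.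
have sz : size (map x (b :: p)) = m.+1 by rewrite size_map.
case: sGT => [[n [lV pV]]|[k [n [km kP]]]].
  exists n.*2 => i; rewrite odd_double doubleK mem_cat => /orP[/lV//|ip].
  have km : (index i (b :: p) < m.+1)%N by rewrite -sp index_mem.
  have := pV _ km; rewrite (component_foldr xpredT) ?sz//.
  by rewrite (nth_map b) ?sp// nth_index.
exfalso; apply: (kP (nth b (b :: p) k)).
  by apply: pA; rewrite mem_nth// sp.
by rewrite (component_foldr xpredT) ?sz// (nth_map b) ?sp.
Qed.


Lemma increasing_enum (l : seq I) : exists2 p, pairwise ltb p & p =i l.
Proof.
pose leb a b := (a == b) || ltb a b.
have leb_total : total leb.
  move=> a b; rewrite /leb; have [ab|->|ba] := lt_total a b; rewrite ?eqxx//.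
    by rewrite /ltb (asboolT ab) orbT.
  by rewrite /ltb (asboolT ba) !orbT.
have leb_trans : transitive leb.
  move=> b a c /predU1P[->//|/asboolP ab] /predU1P[<-|/asboolP bc]; apply/orP; right.
    exact/asboolP.
  exact/asboolP/(lt_trans ab).
exists (sort leb (undup l)) => [|i]; last by rewrite mem_sort mem_undup.
have := sort_sorted leb_total (undup l); rewrite sorted_pairwise// => ple.
have := undup_uniq l; rewrite -(sort_uniq leb) uniq_pairwise => pne.
have := conj ple pne => /andP; rewrite -pairwise_relI; apply: sub_pairwise => a b /=.
by rewrite /leb; case: (a == b) => //=; rewrite andbT.
Qed.

(** The covers are distributed among rows: row [m] serves the increasing tuples of length [m], and
    these list all finite sets. *)
Lemma omega_select_countable x (A : set I) (W : nat -> nat -> set bits) : generic x ->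
  (forall n j, open_bits (W n j)) ->
  (forall n (l : seq I), {in l, forall i, A i} -> exists j, {in l, forall i, W n j (x i)}) ->
  exists f : nat -> nat, forall l : seq I, {in l, forall i, A i} ->
    exists n, {in l, forall i, W n (f n) (x i)}.
Proof.
move=> gx oW cW.
have /choice[f fP] : forall m, exists f : nat -> nat, forall p : seq I, size p = m ->
    pairwise ltb p -> {in p, forall i, A i} ->
    exists n, {in p, forall i, W (code m n) (f n) (x i)}.
  move=> m; have [|||f fP] := @increasing_select x A m gx (fun n => W (code m n)) [set [::]] _ _
    (small1 Kunc _).
  - by move=> n; exact: oW.
  - by move=> n; exact: cW.
  - by move=> _ ->.
  - by exists f => p sp incp pA; have := fP [::] p erefl sp incp pA.
exists (fun i => if @unpickle (nat * nat)%type i is Some (m, n) then f m n else 0%N) => l lA.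
have [p incp pl] := increasing_enum l.
have [|n nP] := fP (size p) p erefl incp; first by move=> i; rewrite pl; exact: lA.
by exists (code (size p) n) => i; rewrite -pl pickleK; exact: nP.
Qed.

(** Countably many members of each cover suffice: for every finite list of cylinders, one member
    that contains them all, if there is any. *)
Lemma omega_select x : generic x -> omega_selective x.
Proof.
move=> gx A U oU cU.
pose cyl (u : seq bool) : set bits := [set s | agree (size u) (nth false u) s].
have /choice[W WP] : forall nw : nat * seq (seq bool), exists V, U nw.1 V /\
    forall V', U nw.1 V' -> {in nw.2, forall u, cyl u `<=` V'} ->
    {in nw.2, forall u, cyl u `<=` V}.
  move=> [n w] /=; have [[V [UV wV]]|nV] := pselect (exists V, U n V /\ {in w, forall u, cyl u `<=` V}).
    by exists V.
  have [//|V UV _] := cU n [::].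
  by exists V; split=> // V' UV' wV'; exfalso; apply: nV; exists V'.
pose W' n j := W (n, odflt [::] (unpickle j)).
have [|n l lA|f fP] := @omega_select_countable x A W' gx.
- by move=> n j; have [/oU] := WP (n, odflt [::] (unpickle j)).
- have [V UV lV] := cU n l lA.
  have /choice[k kP] : forall i, exists k, i \in l -> forall t, agree k (x i) t -> V t.
    move=> i; have [il|nil] := boolP (i \in l); last by exists 0%N.
    by have [k kP] := oU _ _ UV _ (lV i il); exists k.
  pose w := map (fun i => mkseq (x i) (k i)) l.
  exists (pickle w) => i il; rewrite /W' pickleK /=.
  have [_ /(_ V UV) wP] := WP (n, w).
  apply: (wP _ (mkseq (x i) (k i))).
  - move=> _ /mapP[j jl ->] t; rewrite /cyl /= size_mkseq => jt.
    apply: (kP j jl); exact: agree_trans (@agree_mkseq _ _) jt.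
  - exact: map_f.
  - by rewrite /cyl /= size_mkseq; exact/agree_sym/agree_mkseq.
exists (fun n => W' n (f n)) => // n.
by have [] := WP (n, odflt [::] (unpickle (f n))).
Qed.

End Generic.

(** * Function spaces *)

Section CpTopology.
Variables (R : realType) (X : topologicalType).
Local Open Scope ring_scope.

Definition ev (f : Cp R X) (p : X) : R := (f : continuousType X R) p.

Lemma nbhs_Cp (f : Cp R X) (B : set (Cp R X)) :
  nbhs f B <-> exists (l : seq X) (e : R), 0 < e /\
    forall g, {in l, forall p, `|ev f p - ev g p| < e} -> B g.
Proof.
split=> [|[l [e [e0 lB]]]].
  rewrite nbhsE => -[_ [[O oO <-] /= Of] OB].
  pose basic (le : seq X * R) : set (X -> R) := [set g | {in le.1, forall p, `|ev f p - g p| < le.2}].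
  pose F := filter_from [set le : seq X * R | 0 < le.2] basic.
  have FF : Filter F.
    apply: filter_from_filter; first by exists ([::], 1); rewrite /= ltr01.
    move=> [l1 e1] [l2 e2] /= e10 e20; exists (l1 ++ l2, Num.min e1 e2).
      by rewrite /= lt_min e10.
    move=> g /= gP; split=> p pl /=.
      by have := gP p; rewrite mem_cat pl lt_min => /(_ isT)/andP[].
    by have := gP p; rewrite mem_cat pl orbT lt_min => /(_ isT)/andP[].
  have Ff : {ptws, F --> (ev f : X -> R)}.
    apply/pointwise_cvgP => p A /nbhs_ballP[e /= e0 eA].
    exists ([:: p], e) => //= g gP; apply: eA; rewrite /ball /=.
    by apply: gP; rewrite inE.
  have [[l e] /= e0 leO] : F O by apply: Ff; apply: open_nbhs_nbhs.
  by exists l, e; split=> // g gl; apply/OB/leO.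
apply: filterS lB _.
elim: l => [|p l IHl]; first by apply: filterS filterT => g _ p.
have fp : nbhs f [set g | `|ev f p - ev g p| < e].
  have evc : {for f, continuous (fun g : Cp R X => ev g p)}.
    have ic := @initial_continuous _ _ (id : continuousType X R -> {ptws X -> R}).
    by move=> A nA; exact: (ic f _ (@proj_continuous X (fun=> R) p _ A nA)).
  have := evc _ (nbhsx_ballx (ev f p) e e0).
  exact.
apply: filterS (filterI fp IHl) => g [gp gl] q; rewrite inE => /predU1P[-> //|].
exact: gl.
Qed.

Lemma closure_Cp (f : Cp R X) (B : set (Cp R X)) :
  closure B f <-> forall (l : seq X) (e : R), 0 < e ->
    exists2 g, B g & {in l, forall p, `|ev f p - ev g p| < e}.
Proof.
split=> [cB l e e0|H A /nbhs_Cp[l [e [e0 lA]]]].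
  have [|g [Bg gl]] := cB [set g | {in l, forall p, `|ev f p - ev g p| < e}].
    by apply/nbhs_Cp; exists l, e.
  by exists g.
by have [g Bg gl] := H l e e0; exists g; split=> //; exact: lA.
Qed.

End CpTopology.

(* [r] embeds [X] into the Cantor space. *)
Definition coded (X : topologicalType) (r : X -> bits) : Prop :=
  injective r /\ forall p U, nbhs p U <-> exists n, forall q, agree n (r p) (r q) -> U q.

Lemma coded_sub (X : topologicalType) (r : X -> bits) (A : set X) :
  coded r -> coded (r \o (val : set_type A -> X)).
Proof.
move=> [rinj rP]; split=> [|p U]; first exact: inj_comp rinj val_inj.
split=> [|[n nU]].
  rewrite nbhsE => -[_ [[O oO <-] /= Op] OU].
  have /rP[n nO] : nbhs (val p) O by exact: open_nbhs_nbhs.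
  by exists n => q /nO Oq; exact: OU.
have vc := @initial_continuous _ _ (val : set_type A -> X).
have np : nbhs (val p) [set q | agree n (r (val p)) (r q)] by apply/rP; exists n.
have : nbhs p (val @^-1` [set q | agree n (r (val p)) (r q)]) := vc p _ np.
by apply: filterS => q; exact: nU.
Qed.

(* S_1(Omega, Omega), which is equivalent to all finite powers being Rothberger. *)
Definition omega_rothberger (X : topologicalType) : Prop :=
  forall U : nat -> set (set X), (forall n V, U n V -> open V) ->
  (forall n (l : seq X), exists2 V, U n V & {in l, forall p, V p}) ->
  exists2 V : nat -> set X, forall n, U n (V n) &
    forall l : seq X, exists n, {in l, forall p, V n p}.

Lemma omega_rothberger_rothberger (X : topologicalType) :
  omega_rothberger X -> rothberger X.
Proof.
move=> oX U Uc.
(* A finite set needs finitely many members of a cover, which are taken from distinct covers. *)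
pose W n := [set V | exists (m : nat) (B : nat -> set X),
  (forall i, U (code n i) (B i)) /\ V = \bigcup_(i in [set i | (i < m)%N]) B i].
have [||V WV Vl] := oX W.
- move=> n _ [m [B [UB ->]]]; apply: bigcup_open => i _.
  by have [_ + _] := Uc (code n i); apply; exact: UB.
- move=> n l.
  have /choice[B0 B0P] : forall ip : nat * option X, exists B, U (code n ip.1) B /\
      forall p, ip.2 = Some p -> B p.
    move=> [i [p|]]; have [[B UB] _ cB] := Uc (code n i); last by exists B.
    have [B' UB' Bp] : (\bigcup_(A in U (code n i)) A) p by rewrite cB.
    by exists B'; split=> // _ [<-].
  pose B i := B0 (i, onth l i).
  exists (\bigcup_(i in [set i | (i < size l)%N]) B i).
    by exists (size l), B; split=> // i; have [] := B0P (i, onth l i).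
  move=> p pl; exists (index p l) => /=; first by rewrite index_mem.
  have [_ +] := B0P (index p l, onth l (index p l)); apply => /=.
  by rewrite onthE (nth_map p) ?index_mem// nth_index.
have /choice[mB mBP] : forall n, exists mB : nat * (nat -> set X),
    (forall i, U (code n i) (mB.2 i)) /\ V n = \bigcup_(i in [set i | (i < mB.1)%N]) mB.2 i.
  by move=> n; have [m [B BP]] := WV n; exists (m, B).
have /choice[V0 V0P] : forall n, exists B, U n B by move=> n; have [[B UB] _ _] := Uc n; exists B.
(* Decoding need not be injective; the test [code n i == k] ensures that the chosen set belongs to
   [U k]. *)
pose sel k := if @unpickle (nat * nat)%type k is Some (n, i) then
  (if code n i == k then (mB n).2 i else V0 k) else V0 k.
exists sel.
  move=> k; rewrite /sel; case: (unpickle k) => [[n i]|//]; case: eqP => [<-|//].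
  by have [] := mBP n.
apply/seteqP; split=> // p _.
have [n /(_ p (mem_head _ _))] := Vl [:: p].
have [_ ->] := mBP n => -[i _ Bp]; exists (code n i) => //.
by rewrite /sel pickleK eqxx.
Qed.

Section FunctionSpace.
Variables (R : realType) (X : topologicalType) (r : X -> bits).
Hypothesis rX : coded r.
Local Open Scope ring_scope.
Implicit Types (f g : Cp R X) (l : seq X).

(** As [z] lies in the closure of [U n], the open sets [near k f] with [f] in [U n] capture all
    finite sets. Row [k] of the sequence serves precision [k]. *)
Lemma omega_rothberger_strong_fan :
  omega_rothberger X -> countable_strong_fan_tightness (Cp R X).
Proof.
move=> oX z U Uz.
pose near k (f : Cp R X) := [set p | `|ev z p - ev f p| < k.+1%:R^-1].
have /choice[s sP] : forall k : nat, exists s : nat -> Cp R X,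
    (forall n, U (code k n) (s n)) /\ forall l : seq X, exists n, {in l, forall p, near k (s n) p}.
  move=> k; have [||V UV Vl] := oX (fun n => [set near k f | f in U (code k n)]).
  - move=> n _ [f _ <-].
    have cz : continuous (ev z) by exact: (@cts_fun _ _ (z : continuousType X R)).
    have cf : continuous (ev f) by exact: (@cts_fun _ _ (f : continuousType X R)).
    have cd : continuous (fun p => `|ev z p - ev f p|).
      by move=> p; apply: cvg_norm; apply: cvgB; [exact: cz|exact: cf].
    by apply: (open_comp (D := [set x : R | x < k.+1%:R^-1])) => [p _|]; [exact: cd|exact: open_lt].
  - move=> n l.
    have [|f Uf fl] := (closure_Cp z (U (code k n))).1 (Uz _) l k.+1%:R^-1.
      by rewrite invr_gt0 ltr0n.
    by exists (near k f) => //; exists f.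
  - have /choice[s sP] : forall n, exists f, U (code k n) f /\ near k f = V n.
      by move=> n; have [f] := UV n; exists f.
    exists s; split=> [n|l]; first by have [] := sP n.
    by have [n nl] := Vl l; exists n; have [_ ->] := sP n.
have /choice[u0 u0P] : forall n, exists f, U n f.
  by move=> n; have [f Uf _] := (closure_Cp z (U n)).1 (Uz n) [::] 1 ltr01; exists f.
pose sel i := if @unpickle (nat * nat)%type i is Some (k, n) then
  (if code k n == i then s k n else u0 i) else u0 i.
exists sel.
  move=> i; rewrite /sel; case: (unpickle i) => [[k n]|//]; case: eqP => [<-|//].
  by have [] := sP k.
apply/closure_Cp => l e e0.
have [k ke] : exists k : nat, k.+1%:R^-1 < e.
  exists (Num.truncn e^-1); rewrite invf_plt ?posrE ?ltr0n//; exact: truncnS_gt.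
have [_ /(_ l)[n nl]] := sP k; exists (s k n).
  by exists (code k n) => //; rewrite /sel pickleK eqxx.
by move=> p pl; apply: lt_trans ke; exact: nl.
Qed.

(** Dense sets have every point in their closure, so from row [k] one can select a sequence with
    [h k] in its closure. *)
Lemma R_separable_dense_seq (h : nat -> Cp R X) : dense (range h) ->
  countable_strong_fan_tightness (Cp R X) -> R_separable (Cp R X).
Proof.
move=> dh fan D dD.
have cl z n : closure (D n) z.
  move=> O; rewrite nbhsE => -[B [oB Bz] BO].
  by have [|x [Bx Dx]] := dD n B _ oB; [exists z|exists x; split=> //; exact: BO].
have /choice[x xP] : forall k, exists x : nat -> Cp R X,
    (forall n, D (code k n) (x n)) /\ closure (range x) (h k).
  by move=> k; have [x] := fan (h k) (fun n => D (code k n)) (fun n => cl _ _); exists x.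
have /choice[u0 u0P] : forall n, exists f, D n f.
  by move=> n; have [|f [_ Df]] := dD n setT _ openT; [by exists (h 0%N)|exists f].
pose sel i := if @unpickle (nat * nat)%type i is Some (k, n) then
  (if code k n == i then x k n else u0 i) else u0 i.
exists sel.
  move=> i; rewrite /sel; case: (unpickle i) => [[k n]|//]; case: eqP => [<-|//].
  by have [] := xP k.
move=> O O0 oO; have [z [Oz [k _ kz]]] := dh O O0 oO; subst z.
have [_ /(_ O)] := xP k; case; first exact: open_nbhs_nbhs.
move=> _ [[n _ <-] On]; exists (x k n); split=> //.
by exists (code k n) => //; rewrite /sel pickleK eqxx.
Qed.

(* The locally constant function with value [v] on the cylinder of [w] for the entries [(w, v)]
   of [a], and [d] elsewhere. *)
Definition step n (a : seq (seq bool * R)) (d : R) (s : bits) : R :=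
  if [seq u <- a | u.1 == mkseq s n] is u :: _ then u.2 else d.

Lemma step_continuous n a d : exists f, forall p, ev f p = step n a d (r p).
Proof.
pose F p := step n a d (r p).
have cF : continuous F.
  move=> p A /nbhs_singleton Ap; have [_ rP] := rX; apply/rP; exists n => q pq /=.
  suff -> : F q = F p by [].
  rewrite /F /step (_ : mkseq (r q) n = mkseq (r p) n)//.
  by apply/eq_in_map => i; rewrite mem_iota => /andP[_ ni]; rewrite pq.
exists (mkcts cF : continuousType X R).
by [].
Qed.

Lemma separating l n0 : exists2 n, (n0 <= n)%N &
  forall p q, p \in l -> q \in l -> agree n (r p) (r q) -> p = q.
Proof.
have [rinj _] := rX.
have /choice[m mP] : forall pq : X * X, exists m, agree m (r pq.1) (r pq.2) -> pq.1 = pq.2.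
  move=> [p q] /=; apply: contrapT => /forallNP nag.
  have pq : p <> q by move=> pq; apply: (nag 0%N).
  apply: pq; apply: rinj; apply/funext => i.
  by have /not_implyP[+ _] := nag i.+1; exact.
exists (maxn n0 (\max_(pq <- [seq (p, q) | p <- l, q <- l]) m pq)).
  exact: leq_maxl.
move=> p q pl ql pq; apply: (mP (p, q)); apply: agree_le pq => /=.
apply: leq_trans (leq_maxr _ _).
by apply: (leq_bigmax_seq (P := xpredT)) => //; apply: allpairs_f.
Qed.

Lemma stepE n l (v : X -> R) d p :
  (forall q, p \in l -> q \in l -> agree n (r p) (r q) -> p = q) -> p \in l ->
  step n [seq (mkseq (r q) n, v q) | q <- l] d (r p) = v p.
Proof.
move=> sep pl; rewrite /step.
case E : [seq u <- _ | _] => [|u w].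
  have : (mkseq (r p) n, v p) \in [seq u <- [seq (mkseq (r q) n, v q) | q <- l] | u.1 == mkseq (r p) n].
    by rewrite mem_filter eqxx /=; apply: (map_f (fun q => (mkseq (r q) n, v q))).
  by rewrite E.
have : u \in [seq u <- [seq (mkseq (r q) n, v q) | q <- l] | u.1 == mkseq (r p) n].
  by rewrite E mem_head.
rewrite mem_filter => /andP[/eqP uE /mapP[q ql uq]]; subst u => /=.
rewrite (sep q)// => i ni; move: uE => /= /(congr1 (fun s => nth false s i)).
by rewrite !nth_mkseq.
Qed.

Lemma step_default n l (v : X -> R) d p :
  (forall q, q \in l -> ~ agree n (r q) (r p)) ->
  step n [seq (mkseq (r q) n, v q) | q <- l] d (r p) = d.
Proof.
move=> nl; rewrite /step; case E : [seq u <- _ | _] => [//|u w].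
have : u \in [seq u <- [seq (mkseq (r q) n, v q) | q <- l] | u.1 == mkseq (r p) n].
  by rewrite E mem_head.
rewrite mem_filter => /andP[/eqP uE /mapP[q ql uq]]; subst u => /=.
exfalso; apply: (nl q ql) => i ni; move: uE => /= /(congr1 (fun s => nth false s i)).
by rewrite !nth_mkseq.
Qed.

(** Step functions with rational values are countably many, and any finite set of points is
    separated at some level. *)
Lemma Cp_dense_seq : exists h : nat -> Cp R X, dense (range h).
Proof.
pose ratseq (a : seq (seq bool * rat)) : seq (seq bool * R) := [seq (u.1, ratr u.2) | u <- a].
have /choice[h hP] : forall i : nat, exists f, forall p, ev f p =
    (if @unpickle (nat * seq (seq bool * rat))%type i is Some (n, a)
     then step n (ratseq a) 0 (r p) else step 0 [::] 0 (r p)).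
  by move=> i; case: (unpickle i) => [[n a]|]; exact: step_continuous.
exists h => O [f Of] oO.
have /nbhs_Cp[l [e [e0 lO]]] : nbhs f O by exact: open_nbhs_nbhs.
have [n _ sep] := separating l 0.
have /choice[v vP] : forall p, exists v : rat, `|ev f p - ratr v| < e.
  move=> p; have [|q] := @rat_in_itvoo R (ev f p - e) (ev f p + e); first lra.
  by rewrite in_itv /= => /andP[? ?]; exists q; rewrite ltr_norml; apply/andP; split; lra.
pose i := pickle (n, [seq (mkseq (r q) n, v q) | q <- l]).
exists (h i); split; last by exists i.
apply: lO => p pl; rewrite hP /i pickleK /ratseq -map_comp.
have -> : [seq ((fun u => (u.1, ratr u.2)) \o (fun q => (mkseq (r q) n, v q))) q | q <- l] =
  [seq (mkseq (r q) n, (ratr (v q) : R)) | q <- l] by [].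
by rewrite (stepE (fun q => ratr (v q)) 0)// => q; exact: sep.
Qed.

End FunctionSpace.

(** * Failure of the selection principles in the product *)

Section Product.
Variables (R : realType) (X Y : topologicalType) (r : X -> bits) (t : Y -> bits).
Hypotheses (rX : coded r) (tY : coded t).
Hypothesis rows : forall p q, nonzero_rows (xor (r p) (t q)).
Hypothesis dom : forall h : nat -> nat, exists p q N, forall n j,
  (N <= n)%N -> (j < h n)%N -> xor (r p) (t q) (code n j) = false.
Hypothesis X_infinite : forall l : seq X, exists p, p \notin l.
Local Open Scope ring_scope.

(** The pairs with a one among the first [m] entries of row [n] form, as [m] grows, an increasing
    open cover of the product of [X] and [Y]; one member contains the rectangle where both functions
    are below 1 in absolute value. *)
Let covered n (fg : Cp R X * Cp R Y) (m : nat) : Prop := forall p q,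
  `|ev fg.1 p| < 1 -> `|ev fg.2 q| < 1 ->
  exists2 j, (j < m)%N & xor (r p) (t q) (code n j).

(* The first condition lets any finite set of members of [row_bounded n] be avoided by a
   neighbourhood of [0]; it is needed since [dom] only dominates eventually. *)
Definition row_bounded n : set (Cp R X * Cp R Y) :=
  [set fg | (exists p, 1 <= `|ev fg.1 p|) /\ exists m, covered n fg m].

Lemma agree_xor2 n s s' u u' : agree n s s' -> agree n u u' -> agree n (xor s u) (xor s' u').
Proof. by move=> ss' uu' i ni; rewrite /xor ss'// uu'. Qed.

(** Each neighbourhood contains step functions equal to 2 off small cylinders around finitely many
    points; over these cylinders finitely many entries of row [n] suffice. *)
Lemma row_bounded_dense n : dense (row_bounded n).
Proof.
move=> O [[f g] Ofg] oO.
have : nbhs (f, g) O by exact: open_nbhs_nbhs.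
case=> -[A B] /= [/nbhs_Cp[l1 [e1 [e10 lA]]] /nbhs_Cp[l2 [e2 [e20 lB]]]] AB.
have [p0 p0l] := X_infinite l1.
have /choice[j jP] : forall pq : X * Y, exists j, xor (r pq.1) (t pq.2) (code n j).
  by move=> [p q]; exact: rows.
pose pqs := [seq (p, q) | p <- l1, q <- l2].
pose m := (\max_(pq <- pqs) j pq)%N.
(* Agreement on the first [c.+1] bits preserves the first [m.+1] entries of row [n]. *)
pose c := (\max_(i < m.+1) code n i)%N.
(* Separating [p0] from [l1] gives [f'] the value 2 at [p0], as the first condition of [row_bounded]
   asks. *)
have [k1 ck1 sep1] := separating rX (p0 :: l1) c.+1.
have [k2 ck2 sep2] := separating tY l2 c.+1.
have sep1' p q : p \in l1 -> q \in l1 -> agree k1 (r p) (r q) -> p = q.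
  by move=> pl ql; apply: sep1; rewrite inE ?pl ?ql orbT.
have [f' f'P] := step_continuous rX k1 [seq (mkseq (r q) k1, ev f q) | q <- l1] 2.
have [g' g'P] := step_continuous tY k2 [seq (mkseq (t q) k2, ev g q) | q <- l2] 2.
exists (f', g'); split.
  apply: AB; split=> /=.
    by apply: lA => p pl; rewrite f'P (stepE (ev f) 2)// ?subrr ?normr0// => q; exact: sep1'.
  by apply: lB => p pl; rewrite g'P (stepE (ev g) 2)// ?subrr ?normr0// => q; exact: sep2.
split=> /=.
  exists p0; rewrite f'P step_default ?ger0_norm//; first lra.
  move=> q ql qp; have qp0 : q = p0 by apply: sep1 qp; rewrite inE ?ql ?orbT ?eqxx.
  by move: p0l; rewrite -qp0 ql.
exists m.+1 => p q /= fp gq.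
have [p1 p1l pp1] : exists2 p1, p1 \in l1 & agree k1 (r p1) (r p).
  apply: contrapT => np; move: fp; rewrite f'P step_default; first by rewrite ger0_norm; lra.
  by move=> p1 p1l ag; apply: np; exists p1.
have [q1 q1l qq1] : exists2 q1, q1 \in l2 & agree k2 (t q1) (t q).
  apply: contrapT => nq; move: gq; rewrite g'P step_default; first by rewrite ger0_norm; lra.
  by move=> q1 q1l ag; apply: nq; exists q1.
have jm : (j (p1, q1) <= m)%N.
  apply: (leq_bigmax_seq (P := xpredT)) => //; exact: allpairs_f.
exists (j (p1, q1)) => //.
have jc : (code n (j (p1, q1)) < c.+1)%N.
  rewrite ltnS; have jm' : (j (p1, q1) < m.+1)%N by [].
  exact: (leq_bigmax (F := fun i : 'I_m.+1 => code n i) (Ordinal jm')).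
have := jP (p1, q1); rewrite /= (@agree_xor2 c.+1 _ (r p) _ (t q))//.
  exact: agree_le pp1.
exact: agree_le qq1.
Qed.

Lemma dense_closure (Z : topologicalType) (D : set Z) z : dense D -> closure D z.
Proof.
move=> dD O; rewrite nbhsE => -[B [oB Bz] BO].
by have [|x [Bx Dx]] := dD B _ oB; [exists z|exists x; split=> //; exact: BO].
Qed.

(** The bounds of the finite sets define [h]. At the pair given by [dom], rows from [N] on have no
    one in time, so a member of [F n] below 1 there has [n < N]. *)
Lemma no_finite_selection (z : Cp R X * Cp R Y) (F : nat -> set (Cp R X * Cp R Y)) :
  (forall p, ev z.1 p = 0) -> (forall q, ev z.2 q = 0) ->
  (forall n, finite_set (F n) /\ F n `<=` row_bounded n) -> ~ closure (\bigcup_n F n) z.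
Proof.
move=> z1 z2 FP clF.
have /choice[s sP] : forall n, exists s : seq (Cp R X * Cp R Y), F n = [set` s].
  by move=> n; have [/finite_seqP] := FP n.
have [x0 _] := X_infinite [::].
have /choice[b bP] : forall nfg : nat * (Cp R X * Cp R Y), exists b : nat * X,
    F nfg.1 nfg.2 -> 1 <= `|ev nfg.2.1 b.2| /\ covered nfg.1 nfg.2 b.1.
  move=> [n fg] /=; have [Ffg|nF] := pselect (F n fg); last by exists (0%N, x0).
  have [_ /(_ _ Ffg)[[p p1] [m mP]]] := FP n.
  by exists (m, p).
pose h n := (\max_(fg <- s n) (b (n, fg)).1)%N.
have [p [q [N NP]]] := dom h.
(* Being below 1 at these points excludes the finitely many members of the first [N] sets. *)
pose l := p :: flatten [seq [seq (b (n, fg)).2 | fg <- s n] | n <- iota 0 N].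
have nb : nbhs z [set fg : Cp R X * Cp R Y | {in l, forall p, `|ev fg.1 p| < 1} /\ `|ev fg.2 q| < 1].
  exists ([set f | {in l, forall p, `|ev f p| < 1}], [set g | `|ev g q| < 1]) => //=; split.
    apply/nbhs_Cp; exists l, 1; split=> // f fl p' /fl.
    by rewrite z1 sub0r normrN.
  apply/nbhs_Cp; exists [:: q], 1; split=> // g /(_ q (mem_head _ _)).
  by rewrite z2 sub0r normrN.
have [[f g] [[n _ Ffg] [/= fl gq]]] := clF _ nb.
have [b1 bc] := bP (n, (f, g)) Ffg.
have fgs : (f, g) \in s n by move: Ffg; rewrite sP.
have [nN|Nn] := ltnP n N.
  suff : `|ev f (b (n, (f, g))).2| < 1 by rewrite ltNge b1.
  apply: fl; rewrite inE; apply/orP; right; apply/flattenP.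
  exists [seq (b (n, fg)).2 | fg <- s n]; last by apply: (map_f (fun fg => (b (n, fg)).2)).
  by apply/mapP; exists n => //; rewrite mem_iota.
have [j jb] := bc p q (fl p (mem_head _ _)) gq.
rewrite (NP n j)//; apply: leq_trans jb _.
exact: (leq_bigmax_seq (P := xpredT) (F := fun fg => (b (n, fg)).1)).
Qed.

Lemma product_not_selective :
  ~ countable_fan_tightness (Cp R X * Cp R Y)%type /\ ~ M_separable (Cp R X * Cp R Y)%type.
Proof.
have [f f0] := step_continuous rX 0 [::] (0 : R).
have [g g0] := step_continuous tY 0 [::] (0 : R).
have no F := @no_finite_selection (f, g) F f0 g0.
split=> [fan|sep].
  have [|F FP] := fan (f, g) row_bounded; last exact: no.
  by move=> n; exact/dense_closure/row_bounded_dense.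
have [F FP /dense_closure] := sep _ row_bounded_dense.
by move=> /(_ (f, g)); exact: no.
Qed.

End Product.

(** * Sets of reals with prescribed binary digits *)

Section RealCopy.
Variables (R : realType) (I : Type) (x : I -> bits).
Hypothesis x_balanced : forall a, balanced (x a).

Definition real_copy : set R :=
  [set u | dyadic 0 u = 0%R /\ exists a, digits u = x a].

(** Reals of the unit interval with a common prefix are close; conversely, [digits] is continuous at
    reals with infinitely many ones. *)
Lemma coded_real_copy : coded (fun p : set_type real_copy => digits (val p)).
Proof.
have valP' (p : set_type real_copy) : dyadic 0 (val p) = 0%R /\ exists a, digits (val p) = x a.
  exact: (set_mem (valP p)).
split=> [p q pq|p U].
  apply: val_inj; apply/eqP; rewrite -subr_eq0 -normr_le0 leNgt; apply/negP => /pow2_small[n].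
  rewrite ltNge => /negP; apply; apply/ltW/dyadic_close; apply: dyadic_agree.
    by have [-> _] := valP' p; have [-> _] := valP' q.
  by rewrite pq.
split=> [|[n nU]].
  rewrite nbhsE => -[_ [[O oO <-] /= Op] OU].
  have /nbhs_ballP[e /= e0 eO] : nbhs (val p) O by exact: open_nbhs_nbhs.
  have [n ne] := pow2_small e0; exists n => q pq; apply: OU; apply: eO.
  rewrite /ball /=; apply: lt_trans ne; apply/dyadic_close/dyadic_agree => //.
  by have [-> _] := valP' p; have [-> _] := valP' q.
have [_ [a pa]] := valP' p.
have [|e e0 eP] := @digits_continuous R (val p) n.
  by move=> m; rewrite pa; exact: x_balanced.
have vc := @initial_continuous _ _ (val : set_type real_copy -> R).
have : nbhs p (val @^-1` ball (val p) e) := vc p _ (nbhsx_ballx _ e e0).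
apply: filterS => q; rewrite /ball /= => /eP pq; apply: nU.
apply: agree_sym; have [] := @prefix_dyadic R (dyadic 0 (val p)) (digits (val p)) n (val q).
  by rewrite pq -dyadic_prefix.
by [].
Qed.

Lemma real_copy_code a : exists p : set_type real_copy, digits (val p) = x a.
Proof.
have [u u0 ua] := @digits_surj R (x a) (fun n => x_balanced a false n).
by exists (exist _ u (mem_set (conj u0 (ex_intro _ a ua)))).
Qed.

Lemma real_copy_index (p : set_type real_copy) : exists a, digits (val p) = x a.
Proof. by have [] := set_mem (valP p). Qed.

Lemma set_of_reals_real_copy : set_of_reals R (set_type real_copy).
Proof. by exists real_copy, idfun, idfun; split=> // p; exact: cvg_id. Qed.

End RealCopy.

(** [hull] extends an open set of [X] to an open set of the Cantor space with the same trace. Only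
    the indices occurring in [X] are used, so subspaces are covered too. *)
Lemma omega_selective_rothberger (I : choiceType) (x : I -> bits) (X : topologicalType)
    (r : X -> bits) : omega_selective x -> coded r -> (forall p, exists a, r p = x a) ->
  omega_rothberger X.
Proof.
move=> selx [_ rP] rx U oU cU.
pose hull (V : set X) : set bits := [set s | exists p n,
  (forall q, agree n (r p) (r q) -> V q) /\ agree n (r p) s].
have hullP V p : open V -> hull V (r p) <-> V p.
  move=> oV; split=> [[q [n [qV qp]]]|Vp]; first exact: qV.
  have /rP[n nV] : nbhs p V by exact: open_nbhs_nbhs.
  by exists p, n.
have [||V UV Vl] := selx [set a | exists p, r p = x a] (fun n => [set hull V | V in U n]).
- move=> n _ [V _ <-] s [p [m [pV ps]]]; exists m => t st; exists p, m; split=> //.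
  exact: agree_trans st.
- move=> n l lA.
  have /choice[c cP] : forall a, exists o : option X, a \in l -> if o is Some p then r p = x a else False.
    move=> a; have [al|nal] := boolP (a \in l); last by exists None.
    by have [p pa] := lA a al; exists (Some p).
  have [V UV lV] := cU n (pmap c l).
  exists (hull V); first by exists V.
  move=> a al; have := cP a al; case ca : (c a) => [p|//] <-; apply/hullP; first exact: oU UV.
  by apply: lV; rewrite mem_pmap -ca map_f.
have /choice[W WP] : forall n, exists W, U n W /\ hull W = V n.
  by move=> n; have [W] := UV n; exists W.
exists W => [n|l]; first by have [] := WP n.
have /choice[c cP] := rx.
have [|n nl] := Vl (map c l); first by move=> _ /mapP[p _ ->]; exists p; exact: cP.
exists n => p pl; have [UW WV] := WP n.
apply/(hullP (W n) p (oU _ _ UW)); rewrite WV cP; apply: nl; exact: map_f.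
Qed.

Lemma real_copy_properties (R : realType) (I : choiceType) (x : I -> bits) :
  (forall a, balanced (x a)) -> omega_selective x ->
  let X := set_type (real_copy x : set R) in
  [/\ set_of_reals R X, hereditary_rothberger X,
    countable_strong_fan_tightness (Cp R X) & R_separable (Cp R X)].
Proof.
move=> xb selx X.
have cX := coded_real_copy R xb.
have oX : omega_rothberger X.
  exact: (omega_selective_rothberger selx cX (@real_copy_index R I x)).
have fX : countable_strong_fan_tightness (Cp R X) by exact: omega_rothberger_strong_fan.
split=> //; first exact: set_of_reals_real_copy.
- move=> A; apply: omega_rothberger_rothberger.
  apply: (omega_selective_rothberger selx (coded_sub A cX)) => p.
  exact: real_copy_index.
- have [h hd] := Cp_dense_seq R cX; exact: R_separable_dense_seq hd fX.
Qed.

Theorem corollary4p2 (R : realType) (K L : set (set R))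
    (covK : has_card_cov K) (cofL : has_card_cof L)
    (cov_eq_cof : K #= L) (cov_regular : regular_card K) :
  exists X Y : topologicalType,
    [/\ set_of_reals R X, set_of_reals R Y,
        hereditary_rothberger X & hereditary_rothberger Y] /\
    [/\ countable_strong_fan_tightness (Cp R X),
        countable_strong_fan_tightness (Cp R Y),
        R_separable (Cp R X) & R_separable (Cp R Y)] /\
    ~ countable_fan_tightness (Cp R X * Cp R Y)%type /\
    ~ M_separable (Cp R X * Cp R Y)%type.
Proof.
have Kunc : small K [set: nat] by apply: meager_cover_uncountable; case: covK.
have [I [lt [lt_wf lt_trans lt_total lt_small I_large]]] := small_initial_order K.
have [k Kk] : exists k : I -> set R, K `<=` range k by move/negP/smallP/contrapT : I_large.
(* Here cov(M) = cof(M) enters: [I] maps onto [K], and [K] onto [L]. *)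
have LI : ~ small L [set: I].
  have : L #<= K by move: cov_eq_cof; rewrite card_eq_sym card_eq_le => /andP[].
  move=> /pcard_surjP[l Ll] /smallP; apply; exists (l \o k).
  by move=> A /Ll[B /Kk[a _ <-] <-]; exists a.
have common J (A : set J) (G : J -> set bits) := @cov_common R K J A G covK.
have [G cG cofG] := cof_cofinal cofL LI.
have [g gdom] := cofinal_dominating cG cofG.
(* As [x a + y a = t a], this puts the first one in row [n] of that sum at [g a n]. *)
pose t a := of_rows (fun n j => j == g a n).
have t_rows a : nonzero_rows (t a) by move=> n; exists (g a n); rewrite /t of_rowsE.
have [x [y [gx gy xinj xyrows xyP]]] :=
  exists_generic_pair cov_regular Kunc lt_wf lt_total lt_small common G t_rows.
have sel z := @omega_select _ _ cov_regular Kunc _ _ lt_trans lt_total lt_small I_large common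
  _ cG cofG z.
have xb a : balanced (x a) by have [] := xyP a.
have yb a : balanced (y a) by have [] := xyP a.
have [Xr Xh Xf Xs] := real_copy_properties R xb (sel x gx).
have [Yr Yh Yf Ys] := real_copy_properties R yb (sel y gy).
exists (set_type (real_copy x : set R)), (set_type (real_copy y : set R)); split; [by []|split; [by []|]].
apply: (product_not_selective R (coded_real_copy R xb) (coded_real_copy R yb)).
- move=> p q; have [a ->] := real_copy_index p; have [b ->] := real_copy_index q.
  exact: xyrows.
- move=> h; have [a [N NP]] := gdom h.
  have [p pa] := real_copy_code R xb a; have [q qa] := real_copy_code R yb a.
  exists p, q, N => n j Nn jh; rewrite pa qa.
  have [-> _ _] := xyP a; rewrite /xor addbA addbb /= /t of_rowsE.
  by apply/negbTE; rewrite neq_ltn (leq_trans jh)// NP.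
(* If a list exhausted the first set, injectivity of [x] would make [I] finite, hence small. *)
- move=> l; apply: contrapT => nl; apply: I_large.
  have /choice[c cP] := @real_copy_index R I x.
  have lall a : a \in map c l.
    have [p pa] := real_copy_code R xb a.
    have <- : c p = a by apply: xinj; rewrite -cP.
    by apply: map_f; apply/negPn/negP => npl; apply: nl; exists p.
  have [A KA _] : (\bigcup_(A in K) A) 0%R by have [[_ ->] _] := covK.
  have [a0 _ _] := Kk A KA.
  apply: (small_image (g := nth a0 (map c l)) Kunc) => a _.
  by exists (index a (map c l)) => //; rewrite nth_index.
Qed.
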